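(* Let $m\ge2$ be an integer, $L>0$, $\alpha>0$ and $\beta>0$ with $0<\beta\min(\alpha,1)\le1$. Consider the sub-Gaussian model $\mathcal{Y}=\Theta\circ\pi+\mathcal{E}$, where $\pi\in\Pi(d,d)$ is unknown, $\Theta(i_1,\dots,i_m)=f(i_1/d,\dots,i_m/d)$ and $f\in\mathcal{F}(\alpha,L)\cap\mathcal{M}(\beta)$. Denote $$c(\alpha,\beta,m):=\frac{m(m-1)\beta\min(\alpha,1)}{2\big(m-(m-1)\beta\min(\alpha,1)\big)} .$$ Let $(\hat\Theta^{\mathrm{BC}},\hat\pi^{\mathrm{BC}})$ be the Borda count estimator with degree $\ell^*=\min\big(\lceil\alpha-1\rceil,\lfloor c(\alpha,\beta,m)\rfloor\big)$ and block number $k^*\asymp d^{m/(m+2\min(\alpha,\ell^*+1))}$. Then, with high probability, $$\mathrm{MSE}(\hat\Theta^{\mathrm{BC}}\circ\hat\pi^{\mathrm{BC}},\ \Theta\circ\pi)\ \lesssim\ \begin{cases} d^{-\frac{2m\alpha}{m+2\alpha}}, & \text{when }\alpha<c(\alpha,\beta,m),\\[4pt] \Big(\dfrac{\log d}{d^{m-1}}\Big)^{\beta\min(\alpha,1)}, & \text{when }\alpha\ge c(\alpha,\beta,m).\end{cases}$$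
   Context: Notation: $[d]=\{1,\dots,d\}$; $\Pi(d,d)$ is the set of permutations of $[d]$; $\|\cdot\|_F$ is the Frobenius norm. For $\Theta\in\mathbb{R}^{d\times\cdots\times d}$ (order $m$) and $\pi\in\Pi(d,d)$, $(\Theta\circ\pi)(i_1,\dots,i_m)=\Theta(\pi(i_1),\dots,\pi(i_m))$. $\mathrm{MSE}(\Theta_1,\Theta_2)=d^{-m}\|\Theta_1-\Theta_2\|_F^2$. In this paper $\lfloor a\rfloor$ denotes the largest integer strictly smaller than $a$, and $\lceil a\rceil$ the smallest integer no less than $a$. Hölder class: $f:[0,1]^m\to\mathbb{R}$ belongs to $\mathcal{F}(\alpha,L)$ if $\sum_{\kappa\in\mathbb{N}^m:|\kappa|=\lceil\alpha-1\rceil}\frac{1}{\kappa!}|\nabla_\kappa f(x)-\nabla_\kappa f(x_0)|\le L\|x-x_0\|_\infty^{\alpha-\lceil\alpha-1\rceil}$ for all $x,x_0\in[0,1]^m$, where $|\kappa|=\sum_i\kappa_i$, $\kappa!=\prod_i\kappa_i!$ and $\nabla_\kappa=\partial^{|\kappa|}/\partial x_1^{\kappa_1}\cdots\partial x_m^{\kappa_m}$. Marginal monotonicity: $f:[0,1]^m\to\mathbb{R}$ is $\beta$-monotonic, $f\in\mathcal{M}(\beta)$, if for all $d$, $\big(\frac{i-j}{d}\big)^{1/\beta}\lesssim g(i)-g(j)$ for all $j\le i\in[d]$ (with a constant not depending on $d,i,j$), where the score function is $g(i)=d^{-(m-1)}\sum_{(i_2,\dots,i_m)\in[d]^{m-1}}f(i/d,i_2/d,\dots,i_m/d)$.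 Sub-Gaussian model: $\mathcal{E}$ has independent (not necessarily identically distributed) zero-mean sub-Gaussian entries with variance proxy bounded by $\sigma^2=1$. Block-wise polynomial tensors: let $z:[d]\to[k]$, $z(i)=\lceil ki/d\rceil$, and $\mathcal{E}_k=\{z^{-1}(j_1)\times\cdots\times z^{-1}(j_m):(j_1,\dots,j_m)\in[k]^m\}$. $\mathscr{B}(k,\ell)$ is the set of tensors $\mathcal{B}\in\mathbb{R}^{d\times\cdots\times d}$ whose restriction to each block $\Delta\in\mathcal{E}_k$ coincides with a polynomial in $\omega=(i_1,\dots,i_m)$ of degree at most $\ell$, with coefficients depending on $\Delta$. Borda count estimator with parameters $(k,\ell)$: let $\tau(i)=d^{-(m-1)}\sum_{(i_2,\dots,i_m)\in[d]^{m-1}}\mathcal{Y}(i,i_2,\dots,i_m)$ be the empirical score. (1) Sorting: $\hat\pi^{\mathrm{BC}}\in\Pi(d,d)$ is a permutation such that $\tau\circ(\hat\pi^{\mathrm{BC}})^{-1}(1)\le\tau\circ(\hat\pi^{\mathrm{BC}})^{-1}(2)\le\cdots\le\tau\circ(\hat\pi^{\mathrm{BC}})^{-1}(d)$; set $\tilde{\mathcal{Y}}=\mathcal{Y}\circ(\hat\pi^{\mathrm{BC}})^{-1}$. (2) Fitting: $\hat\Theta^{\mathrm{BC}}\in\arg\min_{\Theta'\in\mathscr{B}(k,\ell)}\|\tilde{\mathcal{Y}}-\Theta'\|_F$. Asymptotic conventions ($d\to\infty$, other model quantities fixed): $a_d\lesssim b_d$ means $\lim_{d\to\infty}a_d/b_d\le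 c$ for some constant $c>0$ not depending on $d$; $a_d\asymp b_d$ means $c_1\le\lim a_d/b_d\le c_2$ for some constants $c_1,c_2>0$. An event holds with high probability if its probability tends to $1$ as $d\to\infty$. *)

(* Defs.v *)
From HB Require Import structures.
From mathcomp Require Import all_boot all_order all_algebra all_fingroup.
(* The notations of mpoly clash with those of MathComp-Analysis. *)
From mathcomp Require Import -(notations) mpoly.
From mathcomp Require Import all_classical all_reals all_analysis.

Set Implicit Arguments.
Unset Strict Implicit.
Unset Printing Implicit Defensive.

Import Order.TTheory GRing.Theory Num.Theory.
Import numFieldNormedType.Exports.

Local Open Scope classical_set_scope.
Local Open Scope ring_scope.

Definition strict_floor (R : realType) (a : R) : int := Num.ceil a - 1.

Lemma strict_floorP (R : realType) (a : R) (z : int) :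
  (z <= strict_floor a) = (z%:~R < a).
Proof. by rewrite /strict_floor lerBrDr lezD1 ceil_gt_int. Qed.

(* An order-m tensor on [d]^m.  Indices are 0-based: w : m.-tuple 'I_d stands
   for the multi-index (i_1, ..., i_m) with i_t = (tnth w t).+1. *)
Definition tensor (R : realType) (m d : nat) : Type := m.-tuple 'I_d -> R.

Definition frob (R : realType) (m d : nat) (T : tensor R m d) : R :=
  Num.sqrt (\sum_w T w ^+ 2).

Definition mse (R : realType) (m d : nat) (T1 T2 : tensor R m d) : R :=
  (d%:R ^+ m)^-1 * frob (fun w => T1 w - T2 w) ^+ 2.

Definition tpermute (R : realType) (m d : nat) (T : tensor R m d) (p : 'S_d) :
  tensor R m d := fun w => T (map_tuple p w).

(* Average over the slice whose first index is i. *)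
Definition score (R : realType) (m d : nat) (T : tensor R m d) (i : 'I_d) : R :=
  (d%:R ^+ m.-1)^-1 * \sum_(w : m.-tuple 'I_d | ohead w == Some i) T w.

Definition sample (R : realType) (m d : nat) (f : 'rV[R]_m -> R) :
  tensor R m d := fun w => f (\row_t ((tnth w t).+1%:R / d%:R)).

Definition cube (R : realType) (m : nat) : set 'rV[R]_m :=
  [set x | forall t, 0 <= x 0 t <= 1].

(* G is the t-th partial derivative of F on the closed cube, the difference
   quotient being taken inside the cube (hence one-sided on the faces). *)
Definition is_partial_on_cube (R : realType) (m : nat) (t : 'I_m)
    (F G : 'rV[R]_m -> R) : Prop :=
  forall x, cube x ->
    h^-1 * (F (x + h *: delta_mx 0 t) - F x)
      @[h --> within [set h | cube (x + h *: delta_mx 0 t)] (0 : R)^']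
    --> G x.

(* D is a system of partial derivatives of f on the cube, up to order s:
   D kappa is nabla_kappa f.  Such a D is determined by f on the cube. *)
Definition partials_upto (R : realType) (m s : nat) (f : 'rV[R]_m -> R)
    (D : multinom m -> 'rV[R]_m -> R) : Prop :=
  (forall x, cube x -> D mnm0 x = f x) /\
  forall (kappa : multinom m) (t : 'I_m), (mdeg kappa < s)%N ->
    is_partial_on_cube t (D kappa) (D (mnm_add kappa (mnm1 t))).

Definition holder_order (R : realType) (alpha : R) : nat :=
  `|Num.ceil (alpha - 1)|%N.

Lemma holder_orderE (R : realType) (alpha : R) : 0 < alpha ->
  (holder_order alpha)%:Z = Num.ceil (alpha - 1).
Proof.
move=> alpha0; rewrite gez0_abs// -ltzD1 -ltrBlDr sub0r ceil_gt_int.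
by rewrite ltrBrDr addrC subrr.
Qed.

(* The class F(alpha, L); the norm of 'rV[R]_m is the sup norm.  The sum ranges
   over the multi-indices kappa with |kappa| = s. *)
Definition holder (R : realType) (m : nat) (alpha L : R) (f : 'rV[R]_m -> R) :
    Prop :=
  let s := holder_order alpha in
  exists2 D, partials_upto s f D &
    forall x x0, cube x -> cube x0 ->
      \sum_(kappa : bmultinom m s.+1 | mdeg kappa == s)
         (\prod_(t < m) (kappa t)`!)%:R^-1 * `|D kappa x - D kappa x0|
      <= L * `|x - x0| `^ (alpha - s%:R).

(* The class M(beta): the score of the sampled tensor is the score function g. *)
Definition monotonic (R : realType) (m : nat) (beta : R) (f : 'rV[R]_m -> R) :
    Prop :=
  exists2 C : R, 0 < C &
    forall (d : nat) (i j : 'I_d), (j <= i)%N ->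
      ((i%:R - j%:R) / d%:R) `^ beta^-1
      <= C * (score (sample (d := d) f) i - score (sample (d := d) f) j).

(* z(i) = ceil (k i / d) for the 1-based index i.+1. *)
Definition block_label (d k : nat) (i : 'I_d) : int :=
  Num.ceil ((k * i.+1)%:R / d%:R : rat).

(* The block z^{-1}(j_1) x ... x z^{-1}(j_m). *)
Definition block (m d k : nat) (j : m.-tuple 'I_k) : {set m.-tuple 'I_d} :=
  [set w | [forall t, block_label k (tnth w t) == (tnth j t).+1%:Z]]%SET.

(* msize is the total degree plus one (and 0 for the zero polynomial). *)
Definition block_poly (R : realType) (m d k l : nat) : set (tensor R m d) :=
  [set B | forall j : m.-tuple 'I_k, exists2 p : mpoly m R,
     (msize p <= l.+1)%N &
     forall w, w \in block d j ->
       B w = meval (fun t => (tnth w t).+1%:R) p].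

Definition is_borda_count (R : realType) (m d k l : nat)
    (Y That : tensor R m d) (phat : 'S_d) : Prop :=
  [/\ forall i j : 'I_d, (i <= j)%N ->
        score Y (phat^-1%g i) <= score Y (phat^-1%g j),
      block_poly k l That
    & forall T', block_poly k l T' ->
        frob (fun w => tpermute Y phat^-1%g w - That w)
        <= frob (fun w => tpermute Y phat^-1%g w - T' w)].

Definition crit (R : realType) (alpha beta : R) (m : nat) : R :=
  m%:R * (m%:R - 1) * beta * Num.min alpha 1
  / (2 * (m%:R - (m%:R - 1) * beta * Num.min alpha 1)).

Definition opt_degree (R : realType) (alpha beta : R) (m : nat) : nat :=
  `|Num.min (Num.ceil (alpha - 1)) (strict_floor (crit alpha beta m))|%N.

Lemma opt_degreeE (R : realType) (alpha beta : R) (m : nat) :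
  (2 <= m)%N -> 0 < alpha -> 0 < beta * Num.min alpha 1 <= 1 ->
  (opt_degree alpha beta m)%:Z =
  Num.min (Num.ceil (alpha - 1)) (strict_floor (crit alpha beta m)).
Proof.
move=> m2 alpha0 /andP[b0 b1]; rewrite gez0_abs// le_min; apply/andP; split.
  by rewrite -holder_orderE.
rewrite strict_floorP mulr0z.
set b := beta * _ in b0 b1.
have -> : crit alpha beta m =
    m%:R * (m%:R - 1) * b / (2 * (m%:R - (m%:R - 1) * b)).
  by rewrite /crit /b !mulrA.
move: b b0 b1 => b b0 b1.
have m1 : 0 < m%:R - 1 :> R by rewrite subr_gt0 ltr1n.
have m0 : 0 < m%:R :> R by rewrite ltr0n (leq_trans _ m2).
rewrite divr_gt0 ?mulr_gt0// subr_gt0.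
apply: (@le_lt_trans _ _ (m%:R - 1)); last by rewrite gtrBl.
by rewrite ler_piMr// ltW.
Qed.

Definition borda_rate (R : realType) (alpha beta : R) (m d : nat) : R :=
  if alpha < crit alpha beta m
  then d%:R `^ (- (2 * m%:R * alpha / (m%:R + 2 * alpha)))
  else (ln d%:R / d%:R ^+ m.-1) `^ (beta * Num.min alpha 1).

Definition mutual_indep (dT : measure_display) (T : measurableType dT)
    (R : realType) (P : probability T R) (I : finType)
    (X : I -> {RV P >-> R}) : Prop :=
  forall (J : {set I}) (B : I -> set R), (forall i, measurable (B i)) ->
    P (\bigcap_(i in [set` J]) (X i @^-1` B i))
    = (\prod_(i in J) P (X i @^-1` B i))%E.

Definition centered_subgaussian (dT : measure_display) (T : measurableType dT)
    (R : realType) (P : probability T R) (s2 : R) (X : {RV P >-> R}) : Prop :=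
  [/\ P.-integrable setT (EFin \o X),
      ('E_P[X] = 0)%E
    & forall t : R, ('M_P X t <= (expR (t ^+ 2 * s2 / 2))%:E)%E].

(* Phrased through a measurable sub-event because the estimators, chosen
   arbitrarily among minimizers and ties, need not be measurable; for measurable
   Ev this says that P d (Ev d) tends to 1. *)
Definition with_high_probability (R : realType) (dT : nat -> measure_display)
    (T : forall d, measurableType (dT d)) (P : forall d, probability (T d) R)
    (Ev : forall d, set (T d)) : Prop :=
  exists A : forall d, set (T d),
    [/\ forall d, measurable (A d),
        forall d, A d `<=` Ev d
      & P d (A d) @[d --> \oo] --> 1%E].

Definition same_order (R : realType) (a b : nat -> R) : Prop :=
  exists c1 c2 : R, [/\ 0 < c1, 0 < c2 &
    \forall d \near \oo, c1 * b d <= a d <= c2 * b d].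

(* Main.v *)
(* Let d be large. With probability at least 1 - 2/d two things happen at once:
   every empirical score is within O(sqrt(log d / d^(m-1))) of its mean, and for
   every permutation s of [d] the projection of the s-permuted noise onto the
   space of block-wise polynomials has squared norm O(k^m + d log d); the union
   over all s, which costs log d! <= d log d, is needed because the sorting
   permutation depends on the noise.  By beta-monotonicity the first event forces
   the sorted positions to be within (log d / d^(m-1))^(beta/2) of the true ones
   (relative to d), so Hoelder continuity bounds the misalignment part of the
   error.  On the second event the least-squares fit costs at most a constant
   times this part, plus the approximation error k^(-2 min(alpha, l+1)) given by
   Taylor's formula on each block, plus (k^m + d log d) / d^m.  The critical value
   of alpha is where d^(-2 m a / (m + 2 a)) crosses d^(-(m-1) beta min(alpha, 1)). *)

(* Two obstacles shape the proof. The sub-Gaussian hypothesis controls exponentials of linear forms,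
   whereas the squared norm of the projected noise is quadratic: its exponential moment is reached
   by summing linear exponentials over an integer lattice of directions, and orthogonality turns
   this into a tail bound $e^{4N-t/4}$ in dimension $N$. The thresholds $16N+8d\log d$ and $16+8\log
   d$ are chosen so that this bound leaves $d^{-2d}$ and $d^{-2}$, which survive the unions over at
   most $d^d$ permutations and over $d$ scores. Secondly, the estimators need not be measurable, so
   the good event is defined from the noise alone; what follows on it is a deterministic inequality,
   valid for every choice among ties and minimizers. The noise enters the fit only through its inner
   product with a difference of two block-wise polynomials, which is why the norm of a projection
   suffices. The union over permutations costs $d\log d/d^m=\log d/d^{m-1}$, and this is dominated
   by the sorting error because $\beta\min(\alpha,1)\le1$. *)
Require Import Defs.
From HB Require Import structures.
From mathcomp Require Import all_boot all_order all_algebra all_fingroup.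
From mathcomp Require Import -(notations) mpoly.
From mathcomp Require Import all_classical all_reals all_analysis.
From mathcomp Require Import measurable_realfun ring lra.

Import Order.TTheory GRing.Theory Num.Theory.
Import numFieldNormedType.Exports HBNNSimple.

Local Open Scope classical_set_scope.
Local Open Scope ring_scope.

(** * Exponential moments of independent sub-Gaussian variables *)

(** Simple functions of [X] first, then monotone convergence. [G] is an arbitrary weight rather than
    a random variable so that it can be a product of other factors times the indicator of an
    event. *)
Lemma integral_comp_indep {dT : measure_display} {T : measurableType dT}
    {R : realType} (P : probability T R) (X : {RV P >-> R})
    (G : T -> R) (h : R -> R) :
  measurable_fun [set: T] G -> (forall x, 0 <= G x) ->
  measurable_fun [set: R] h -> (forall x, 0 <= h x) ->
  (\int[P]_x (G x)%:E \is a fin_num)%E ->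
  (forall B, measurable B ->
     \int[P]_(x in X @^-1` B) (G x)%:E = P (X @^-1` B) * \int[P]_x (G x)%:E)%E ->
  (\int[P]_x ((h (X x))%:E * (G x)%:E) = \int[P]_x (h (X x))%:E * \int[P]_x (G x)%:E)%E.
Proof.
move=> mG G0 mh h0 EG GB.
have mX B : measurable B -> measurable (X @^-1` B).
  by move=> mB; rewrite -[X in measurable X]setTI; exact: measurable_funPT.
have mEh : measurable_fun setT (EFin \o h) by exact/measurable_EFinP.
pose s := nnsfun_approx measurableT mEh.
have mi y n : measurable_fun setT (fun x => (y * \1_(s n @^-1` [set y]) (X x))%:E).
  apply/measurable_EFinP; apply: measurable_funM => //.
  by apply: measurableT_comp => //; exact: measurable_indic.
have yi n y x : 0 <= y * \1_(s n @^-1` [set y]) x.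
  have [y0|y0] := leP 0 y; first by rewrite mulr_ge0.
  rewrite indicE memNset ?mulr0// => /= xy.
  by have := @fun_ge0 _ _ (s n) x; rewrite /= xy leNgt y0.
have mEG : measurable_fun [set: T] (EFin \o G) by exact/measurable_EFinP.
have EG0 : (0 <= \int[P]_x (G x)%:E)%E by apply: integral_ge0 => x _; rewrite lee_fin.
have sE n : (\int[P]_x ((s n (X x))%:E * (G x)%:E)
             = \int[P]_x (s n (X x))%:E * \int[P]_x (G x)%:E)%E.
  pose r := finmap.enum_fset (fset_set (range (s n))).
  have snE x : (s n (X x))%:E = (\sum_(y <- r) (y * \1_(s n @^-1` [set y]) (X x))%:E)%E.
    by rewrite fimfunE fsbig_finite//= sumEFin.
  transitivity (\int[P]_x (\sum_(y <- r)
      ((y * \1_(s n @^-1` [set y]) (X x))%:E * (G x)%:E)))%E.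
    by apply: eq_integral => x _; rewrite snE ge0_sume_distrl// => y _; rewrite lee_fin.
  rewrite ge0_integral_sum//; last 2 first.
  - by move=> y; exact: emeasurable_funM.
  - by move=> y x _; rewrite mule_ge0// lee_fin.
  under [in RHS]eq_integral do rewrite snE.
  rewrite ge0_integral_sum//; last by move=> y x _; rewrite lee_fin.
  rewrite ge0_sume_distrl; last by move=> y _; apply: integral_ge0 => x _; rewrite lee_fin.
  apply: eq_big_seq => y; rewrite in_fset_set// inE => -[z _ yz].
  have y0 : 0 <= y by rewrite -yz.
  have mB : measurable (s n @^-1` [set y]).
    by rewrite -[X in measurable X]setTI; exact: measurable_funPT.
  have m1 : measurable_fun [set: T] (fun x => (\1_(s n @^-1` [set y]) (X x))%:E : \bar R).
    by apply/measurable_EFinP; apply: measurableT_comp => //; exact: measurable_indic.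
  under eq_integral do rewrite EFinM -muleA.
  rewrite ge0_integralZl//; last 2 first.
  - exact: emeasurable_funM.
  - by move=> x _; rewrite mule_ge0// lee_fin.
  under [in RHS]eq_integral do rewrite EFinM.
  rewrite ge0_integralZl//.
  rewrite -muleA; congr (_ * _)%E.
  rewrite [X in (X * _)%E](_ : _ = P (X @^-1` (s n @^-1` [set y]))); last first.
    by rewrite -(setIT (X @^-1` _)) -integral_indic//; exact: mX.
  rewrite -GB// [RHS]integral_mkcond; apply: eq_integral => x _.
  rewrite patchE/= indicE.
  rewrite [x \in _](_ : _ = (X x \in s n @^-1` [set y])).
    by case: (X x \in _); rewrite ?mul1e ?mul0e.
  by apply/idP/idP; rewrite !inE.
have ms n : measurable_fun setT (fun x => (s n (X x))%:E).
  by apply/measurable_EFinP; apply: measurableT_comp.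
have cs x : (s n (X x))%:E @[n --> \oo] --> (h (X x))%:E.
  apply: (@cvg_nnsfun_approx _ _ _ _ measurableT _ mEh) => // y _.
  by rewrite lee_fin.
have nds x : {homo (fun n => (s n (X x))%:E) : n m / (n <= m)%N >-> (n <= m)%E}.
  move=> a b ab; rewrite lee_fin.
  by have /lefP := @nd_nnsfun_approx _ _ _ _ measurableT _ mEh a b ab; exact.
have c1 (H : T -> R) : measurable_fun [set: T] H -> (forall x, 0 <= H x) ->
    (\int[P]_x ((s n (X x))%:E * (H x)%:E) @[n --> \oo]
       --> \int[P]_x ((h (X x))%:E * (H x)%:E))%E.
  move=> mH H0; rewrite [X in _ --> X](_ : _ =
      (\int[P]_x (limn (fun n => (s n (X x))%:E * (H x)%:E)))%E); last first.
    by apply: eq_integral => x _; apply/esym/cvg_lim => //; exact: cvgeZr.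
  apply: cvg_monotone_convergence => //.
  - by move=> n; apply: emeasurable_funM => //; exact/measurable_EFinP.
  - by move=> n x _; rewrite mule_ge0// lee_fin.
  - by move=> x _ a b ab; rewrite lee_wpmul2r//; [rewrite lee_fin|exact: nds].
apply: (@cvg_unique _ (@ereal_hausdorff R) _ _ _ _ (c1 G mG G0)).
rewrite (funext sE); apply: cvgeZr => //.
have e1 (u : T -> R) : (\int[P]_x ((u x)%:E * (cst 1 x)%:E) = \int[P]_x (u x)%:E)%E.
  by under eq_integral do rewrite mule1.
have := c1 (cst 1) (measurable_cst _) (fun=> ler01).
by rewrite e1 (funext (fun n => e1 (s n \o X))).
Qed.

(** [mutual_indep] speaks of events only, so the induction has to carry an intersection of events
    together with the product of functions. *)
Lemma integral_prod_indep {dT : measure_display} {T : measurableType dT}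
    {R : realType} (P : probability T R) (I : finType) (X : I -> {RV P >-> R})
    (h : I -> R -> R) :
  mutual_indep X ->
  (forall i, measurable_fun [set: R] (h i)) -> (forall i x, 0 <= h i x) ->
  (forall i, \int[P]_x (h i (X i x))%:E \is a fin_num)%E ->
  (\int[P]_x (\prod_i h i (X i x))%:E = \prod_i \int[P]_x (h i (X i x))%:E)%E.
Proof.
move=> indX mh h0 hfin.
have mX i B : measurable B -> measurable (X i @^-1` B).
  by move=> mB; rewrite -[X in measurable X]setTI; exact: measurable_funPT.
have mcap (J : {set I}) (B : I -> set R) : (forall i, measurable (B i)) ->
    measurable (\bigcap_(i in [set` J]) (X i @^-1` B i)).
  move=> mB; apply: fin_bigcap_measurable => // i _; exact: mX.
have mh' i : measurable_fun [set: T] (fun x => h i (X i x)).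
  exact: measurableT_comp.
(* The functions [h i] replace indicators one index at a time. *)
have main : forall (s : seq I) (J : {set I}) (B : I -> set R), uniq s ->
    (forall i, i \in s -> i \notin J) -> (forall i, measurable (B i)) ->
    (\int[P]_(x in \bigcap_(i in [set` J]) (X i @^-1` B i))
       (\prod_(i <- s) h i (X i x))%:E
     = \prod_(i <- s) \int[P]_x (h i (X i x))%:E *
       \prod_(i in J) P (X i @^-1` B i))%E.
  elim=> [|i s IH] J B.
    move=> _ _ mB; rewrite big_nil mul1e -indX//.
    under eq_integral do rewrite big_nil.
    by rewrite integral_cst ?mul1e//; exact: mcap.
  move=> /andP[si us] sJ mB.
  pose A := \bigcap_(i in [set` J]) (X i @^-1` B i).
  have mA : measurable A by exact: mcap.
  pose G x := \prod_(i <- s) h i (X i x) * \1_A x.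
  have GE D : measurable D -> (\int[P]_(x in D) (G x)%:E
      = \int[P]_(x in D `&` A) (\prod_(i <- s) h i (X i x))%:E)%E.
    move=> mD; rewrite [RHS]integral_mkcondr; apply: eq_integral => x _.
    rewrite /G patchE indicE.
    by case: (x \in A); rewrite ?mulr1 ?mulr0.
  have sJ' k : k \in s -> k \notin J by move=> ks; rewrite sJ// inE ks orbT.
  have EG : (\int[P]_x (G x)%:E = \prod_(i <- s) \int[P]_x (h i (X i x))%:E *
       \prod_(i in J) P (X i @^-1` B i))%E.
    by rewrite GE// setTI IH.
  have := @integral_comp_indep _ _ _ P (X i) G (h i).
  rewrite EG => step.
  transitivity (\int[P]_x ((h i (X i x))%:E * (G x)%:E))%E.
    rewrite integral_mkcond; apply: eq_integral => x _.
    rewrite /G patchE indicE -/A big_cons.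
    by case: (x \in A); rewrite ?mulr1 ?mulr0 ?mule0 ?EFinM.
  rewrite step ?big_cons ?muleA//.
  - apply: measurable_funM; last exact: measurable_indic.
    exact: measurable_prod.
  - by move=> x; rewrite /G mulr_ge0// prodr_ge0.
  - rewrite fin_numM//; apply: (big_ind (fun x : \bar R => x \is a fin_num)) => //.
    + by move=> *; rewrite fin_numM.
    + by move=> *; rewrite fin_numM.
    + by move=> k _; rewrite fin_num_measure//; exact: mX.
  - move=> D mD; rewrite GE; last exact: mX.
    (* The event [D] for [X i] is absorbed into the intersection, so that the induction hypothesis
       applies to the shorter list with [i |: J]. *)
    pose B' k := if k == i then D else B k.
    have iJ : i \notin J by rewrite sJ// inE eqxx.
    rewrite (_ : _ `&` _ = \bigcap_(k in [set` i |: J]) (X k @^-1` B' k)); last first.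
      apply/seteqP; split => [x [Di Ax] k /=|x Ax].
        rewrite !inE /B'; have [->//|_ /= kJ] := eqVneq k i.
        exact: Ax.
      split; first by have := Ax i; rewrite /= !inE eqxx /B' eqxx; exact.
      move=> k /= kJ; have := Ax k; rewrite /= !inE kJ orbT /B' => /(_ isT).
      by case: eqP => // ki; rewrite -ki kJ in iJ.
    rewrite IH//; last 2 first.
    + move=> k ks; rewrite !inE negb_or sJ'// andbT.
      by apply: contraNneq si => <-.
    + by move=> k; rewrite /B'; case: ifP.
    rewrite big_setU1//= {1}/B' eqxx muleCA; congr (_ * (_ * _))%E.
    by apply: eq_bigr => k kJ; rewrite /B'; case: eqP => // ki; rewrite -ki kJ in iJ.
have := main (index_enum I) (@finset.set0 I) (fun=> setT) (index_enum_uniq I).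
rewrite big_set0 mule1 => <-//; last by move=> i _; rewrite inE.
rewrite (_ : \bigcap_(i in _) _ = setT)//.
by apply/seteqP; split => // x _ i.
Qed.

(** The sub-Gaussian bound on each factor also supplies the finiteness that the factorization asks
    for. *)
Lemma expectation_exp_sum {dT : measure_display} {T : measurableType dT}
    {R : realType} (P : probability T R) (I : finType) (X : I -> {RV P >-> R})
    (a : I -> R) :
  mutual_indep X -> (forall i, centered_subgaussian 1 (X i)) ->
  (\int[P]_x (expR (\sum_i a i * X i x))%:E <= (expR ((\sum_i a i ^+ 2) / 2))%:E)%E.
Proof.
move=> indX sgX.
have bnd i : (\int[P]_x (expR (a i * X i x))%:E <= (expR (a i ^+ 2 / 2))%:E)%E.
  have [_ _ /(_ (a i))] := sgX i.
  rewrite /mmt_gen_fun unlock mulr1; apply: le_trans.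
  by rewrite le_eqVlt; apply/orP; left; apply/eqP; apply: eq_integral => x _ /=; rewrite mulrC.
have fin i : (\int[P]_x (expR (a i * X i x))%:E)%E \is a fin_num.
  rewrite ge0_fin_numE; last by apply: integral_ge0 => x _; rewrite lee_fin expR_ge0.
  by apply: le_lt_trans (bnd i) _; rewrite ltry.
under eq_integral do rewrite expR_sum.
rewrite (integral_prod_indep P I X (fun i x => expR (a i * x)) indX _ _ fin);
  [|by move=> i; apply: measurableT_comp => //; exact: mulrl_measurable
   |by move=> i x; exact: expR_ge0].
rewrite mulr_suml expR_sum -prodEFin.
suff /andP[] : (0 <= \prod_i \int[P]_x (expR (a i * X i x))%:E
    <= \prod_i (expR (a i ^+ 2 / 2))%:E)%E by [].
apply: (big_ind2 (fun u v : \bar R => 0 <= u <= v)%E) => [|u v u' v'|i _].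
- by rewrite lexx lee01.
- by move=> /andP[u0 uv] /andP[u'0 uv']; rewrite mule_ge0//= lee_pmul.
- by rewrite bnd andbT; apply: integral_ge0 => x _; rewrite lee_fin expR_ge0.
Qed.

(** * Tail of the projected noise *)

(** Signed integers coded by magnitude and sign. Zero occurs twice, which is harmless because the
    lattice sums are only compared by inequalities. *)
Definition sgnat {R : realType} (p : nat * bool) : R := (-1) ^+ p.2 * p.1%:R.

Lemma sqr_sgnat {R : realType} (p : nat * bool) : sgnat p ^+ 2 = p.1%:R ^+ 2 :> R.
Proof. by rewrite /sgnat exprMn sqrr_sign mul1r. Qed.

(* Maximising q z - q ^ 2 over integers q recovers z ^ 2 / 4 up to 1 / 4.  Summing
   exponentials over a lattice of directions thus plays the role of a Gaussian
   mixture and bounds the tail of a norm from linear exponential moments alone. *)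
Lemma expR_sqr_le_lattice {R : realType} (M : nat) (t z : R) :
  0 <= t -> t <= M%:R ^+ 2 ->
  expR (Num.min (z ^+ 2) t / 4 - 4^-1)
  <= \sum_(p : 'I_M.+1 * bool)
       expR (sgnat (p.1 : nat, p.2) * z - sgnat (p.1 : nat, p.2) ^+ 2).
Proof.
move=> t0 tM.
have term (q : nat) : (q <= M)%N -> expR (q%:R * `|z| - q%:R ^+ 2)
  <= \sum_(p : 'I_M.+1 * bool)
       expR (sgnat (p.1 : nat, p.2) * z - sgnat (p.1 : nat, p.2) ^+ 2).
  move=> qM; have qM' : (q < M.+1)%N by [].
  rewrite (bigD1 (Ordinal qM', z < 0))//= !sqr_sgnat/= -[leLHS]addr0 lerD//.
    rewrite /sgnat/= ler_expR lerD2r mulrAC [leRHS]mulrC ler_wpM2l//.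
    by rewrite real_normrEsign// num_real.
  by apply: sumr_ge0 => p _; exact: expR_ge0.
have [zM|zM] := lerP `|z| (2 * M%:R).
  (* [q] is an integer nearest to $|z|/2$, and $q|z|-q^2=z^2/4-(q-|z|/2)^2$ with the last square at
     most $1/4$. *)
  have h0 : 0 <= `|z| / 2 + 2^-1 by rewrite addr_ge0// divr_ge0.
  have /andP[q1 q2] := truncn_itv h0.
  set q := Num.truncn _ in q1 q2.
  have qM : (q <= M)%N.
    rewrite -ltnS -(ltr_nat R) (le_lt_trans q1)// -(natr1 M).
    by have : 0 <= M%:R :> R by []; lra.
  apply: le_trans (term q qM); rewrite ler_expR.
  have zz : z ^+ 2 = `|z| ^+ 2 by rewrite real_normK// num_real.
  have : Num.min (z ^+ 2) t <= `|z| ^+ 2 by rewrite zz ge_min lexx.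
  rewrite -(natr1 q) in q2; move: (Num.min _ _) => u zu.
  have : 0 <= (q%:R - `|z| / 2 + 2^-1) * (`|z| / 2 + 2^-1 - q%:R).
    by apply: mulr_ge0; lra.
  by move: zu; rewrite expr2; nra.
(* Beyond the range of the lattice, $q=M$ already gives $M|z|-M^2\ge M^2\ge t$. The truncation at
   [t] is what allows a finite lattice. *)
apply: le_trans (term M (leqnn M)); rewrite ler_expR.
have : Num.min (z ^+ 2) t <= t by rewrite ge_min lexx orbT.
have : 0 <= M%:R :> R by [].
by move: (Num.min _ _) zM tM => u; nra.
Qed.

Lemma expR_half_inv_le {R : realType} : expR (- 2^-1) <= 2 / 3 :> R.
Proof.
rewrite expRN -invf_div lef_pV2 ?posrE ?expR_gt0 ?divr_gt0//.
by apply: le_trans (expR_ge1Dx _); lra.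
Qed.

(** Since $q^2\ge q$ and $e^{-1/2}\le 2/3$, the terms are below a geometric series of sum 3, counted
    once for each sign. *)
Lemma sum_lattice_le {R : realType} (M : nat) :
  \sum_(p : 'I_M.+1 * bool) expR (- (sgnat (p.1 : nat, p.2) ^+ 2 / 2)) <= 6 :> R.
Proof.
under eq_bigr do rewrite sqr_sgnat/=.
rewrite -(pair_big xpredT xpredT (fun (q : 'I_M.+1) (b : bool) => expR (- (q%:R ^+ 2 / 2))))/=.
under eq_bigr do rewrite sumr_const card_bool.
have bnd (q : nat) : expR (- (q%:R ^+ 2 / 2)) <= (2 / 3) ^+ q :> R.
  apply: (@le_trans _ _ (expR (- 2^-1) ^+ q)); last first.
    by apply: lerXn2r; rewrite ?nnegrE ?expR_ge0 ?divr_ge0// expR_half_inv_le.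
  rewrite -expRM_natl ler_expR.
  have [->|q0] := posnP q; first by rewrite expr2 !mul0r oppr0.
  have : 1 <= q%:R :> R by rewrite ler1n.
  by nra.
apply: (@le_trans _ _ (\sum_(q < M.+1) 2 * (2 / 3) ^+ q)).
  by apply: ler_sum => q _; rewrite -[leLHS]mulr_natl ler_wpM2l.
rewrite -mulr_sumr.
have -> : \sum_(q < M.+1) (2 / 3 : R) ^+ q = 3 * (1 - (2 / 3) ^+ M.+1).
  elim: M => [|M IH]; first by rewrite big_ord1 expr0 expr1; lra.
  by rewrite big_ord_recr/= IH [in RHS]exprS; lra.
have : 0 <= (2 / 3 : R) ^+ M.+1 by rewrite exprn_ge0// divr_ge0.
by lra.
Qed.

(** Markov's inequality for [F], a product of $N$ lattice sums. Expanded over functions [f], it is a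
    sum of exponentials of linear forms in [X], whose coefficient vector has squared norm at most
    $\sum_j c(f_j)^2$ by orthogonality. Half of the penalty $-\sum_j c(f_j)^2$ therefore survives,
    and the expectation is at most $6^N\le e^{3N}$. On the event, $F\ge e^{t/4-N/4}$. *)
Lemma sum_sqr_lin_indep_tail {dT : measure_display} {T : measurableType dT}
    {R : realType} (P : probability T R) (I : finType) (X : I -> {RV P >-> R})
    (N : nat) (e : 'I_N -> I -> R) (t : R) :
  mutual_indep X -> (forall i, centered_subgaussian 1 (X i)) ->
  (forall j k, j != k -> \sum_i e j i * e k i = 0) ->
  (forall j, \sum_i e j i ^+ 2 <= 1) -> 0 <= t ->
  (P [set x | (t <= \sum_j (\sum_i e j i * X i x) ^+ 2)%R]
     <= (expR (4 * N%:R - t / 4))%:E)%E.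
Proof.
move=> indX sgX orth norm1 t0.
pose Z j x := \sum_i e j i * X i x.
have [M tM] : exists M : nat, t <= M%:R ^+ 2.
  exists (Num.truncn t).+1.
  have /andP[_ /ltW] := truncn_itv t0; set u := _%:R => tu.
  have : 1 <= u by rewrite ler1n.
  by nra.
pose Q := ('I_M.+1 * bool)%type.
pose c (q : Q) : R := sgnat (q.1 : nat, q.2).
pose F x := \prod_j \sum_(q : Q) expR (c q * Z j x - c q ^+ 2).
pose a (f : {ffun 'I_N -> Q}) i := \sum_j c (f j) * e j i.
have FE x : F x = \sum_(f : {ffun 'I_N -> Q})
    expR (- \sum_j c (f j) ^+ 2) * expR (\sum_i a f i * X i x).
  rewrite /F bigA_distr_bigA; apply: eq_bigr => f _.
  rewrite -expR_sum -expRD; congr expR; rewrite sumrB addrC; congr (_ + _).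
  under eq_bigr do rewrite mulr_sumr.
  rewrite exchange_big; apply: eq_bigr => i _.
  by rewrite /a mulr_suml; apply: eq_bigr => j _; rewrite mulrA.
have aE f : \sum_i a f i ^+ 2 <= \sum_j c (f j) ^+ 2.
  have -> : \sum_i a f i ^+ 2 = \sum_j c (f j) ^+ 2 * \sum_i e j i ^+ 2.
    under eq_bigr => i _.
      rewrite expr2 /a mulr_suml.
      under eq_bigr do rewrite mulr_sumr.
      over.
    rewrite exchange_big; apply: eq_bigr => j _.
    rewrite exchange_big (bigD1 j)//= [X in _ + X]big1 ?addr0.
      by rewrite mulr_sumr; apply: eq_bigr => i _; ring.
    move=> k kj; transitivity (c (f j) * c (f k) * \sum_i e j i * e k i).
      by rewrite mulr_sumr; apply: eq_bigr => i _; ring.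
    by rewrite orth ?mulr0// eq_sym.
  by apply: ler_sum => j _; rewrite ler_piMr// sqr_ge0.
have mZ j : measurable_fun [set: T] (Z j).
  by apply: measurable_sum => i; exact: measurable_funM.
have mXs (f : {ffun 'I_N -> Q}) : measurable_fun [set: T]
    (fun x => (expR (- \sum_j c (f j) ^+ 2) * expR (\sum_i a f i * X i x))%:E).
  apply/measurable_EFinP; apply: measurable_funM => //.
  apply: measurableT_comp => //.
  by apply: measurable_sum => i; exact: measurable_funM.
have EF : (\int[P]_x (F x)%:E <= (expR (3 * N%:R))%:E)%E.
  under eq_integral do rewrite FE -sumEFin.
  rewrite ge0_integral_sum//.
  apply: (@le_trans _ _ (\sum_(f : {ffun 'I_N -> Q})
     (\prod_j expR (- (c (f j) ^+ 2 / 2)))%:E)%E).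
    apply: lee_sum => f _; under eq_integral do rewrite EFinM.
    rewrite ge0_integralZl_EFin ?expR_ge0//; last first.
      apply/measurable_EFinP; apply: measurableT_comp => //.
      by apply: measurable_sum => i; exact: measurable_funM.
    apply: (@le_trans _ _ ((expR (- \sum_j c (f j) ^+ 2))%:E *
        (expR ((\sum_i a f i ^+ 2) / 2))%:E)%E).
      by rewrite lee_wpmul2l ?lee_fin ?expR_ge0//; exact: expectation_exp_sum.
    rewrite -EFinM lee_fin -expRD -expR_sum ler_expR sumrN -mulr_suml.
    by have := aE f; lra.
  rewrite sumEFin lee_fin.
  rewrite -(bigA_distr_bigA (fun j (q : Q) => expR (- (c q ^+ 2 / 2)))).
  apply: (@le_trans _ _ (\prod_(j < N) 6)).
    apply: ler_prod => j _; rewrite sum_lattice_le andbT.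
    by apply: sumr_ge0 => q _; exact: expR_ge0.
  rewrite prodr_const card_ord expRM_natr.
  apply: lerXn2r; rewrite ?nnegrE ?expR_ge0//.
  have -> : 3 = 1 + 1 + 1 :> R by lra.
  rewrite !expRD; have : 2 <= expR (1 : R) by apply: le_trans (expR_ge1Dx _); lra.
  by nra.
have Fge x : t <= \sum_j Z j x ^+ 2 -> expR (t / 4 - N%:R / 4) <= F x.
  move=> tZ; apply: (@le_trans _ _ (\prod_j expR (Num.min (Z j x ^+ 2) t / 4 - 4^-1))).
    rewrite -expR_sum ler_expR sumrB -mulr_suml sumr_const card_ord.
    rewrite -[4^-1 *+ N]mulr_natl lerD2r ler_wpM2r//.
    (* A single square reaching [t] suffices by itself; otherwise the truncation is inactive in
       every coordinate. *)
    have [[j tj]|tj] := pselect (exists j, t <= Z j x ^+ 2).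
      rewrite (bigD1 j)//= (min_idPr tj) lerDl.
      by apply: sumr_ge0 => k _; rewrite le_min sqr_ge0.
    rewrite (eq_bigr (fun j => Z j x ^+ 2))// => j _; apply/min_idPl.
    by rewrite leNgt; apply/negP => /ltW ?; apply: tj; exists j.
  by apply: ler_prod => j _; rewrite expR_ge0/= expR_sqr_le_lattice.
pose A := [set x | t <= \sum_j Z j x ^+ 2].
have mS : measurable_fun [set: T] (fun x => \sum_j Z j x ^+ 2).
  by apply: measurable_sum => j; exact: measurable_funX.
have mA : measurable A.
  rewrite -[A]setTI (_ : A = (fun x => \sum_j Z j x ^+ 2) @^-1` `[t, +oo[%classic).
    exact: mS.
  by apply/seteqP; split=> x; rewrite /A/= in_itv/= andbT.
have mF : measurable_fun [set: T] F.
  rewrite (funext FE); apply: measurable_sum => f; exact/measurable_EFinP/mXs.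
have key : ((expR (t / 4 - N%:R / 4))%:E * P A <= (expR (3 * N%:R))%:E)%E.
  apply: le_trans EF; rewrite -integral_cst//.
  apply: (@le_trans _ _ (\int[P]_(x in A) (F x)%:E)%E).
    apply: ge0_le_integral => //.
    - by move=> x _; rewrite lee_fin expR_ge0.
    - by apply/measurable_EFinP; apply: measurable_funTS.
  apply: ge0_subset_integral => //; first exact/measurable_EFinP.
  move=> x _; rewrite lee_fin; apply: prodr_ge0 => j _.
  by apply: sumr_ge0 => q _; exact: expR_ge0.
rewrite -/A; move: key; rewrite -lee_pdivlMl ?expR_gt0// => /le_trans; apply.
rewrite -expRN -EFinM -expRD lee_fin ler_expR.
by have : 0 <= N%:R :> R by []; lra.
Qed.

(** * Least squares and sorting *)

Lemma cauchy_schwarz_sum {R : realType} (I : finType) (u v : I -> R) :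
  (\sum_i u i * v i) ^+ 2 <= (\sum_i u i ^+ 2) * (\sum_i v i ^+ 2).
Proof.
have : 0 <= \sum_i \sum_j (u i * v j - u j * v i) ^+ 2.
  by apply: sumr_ge0 => i _; apply: sumr_ge0 => j _; exact: sqr_ge0.
have -> : \sum_i \sum_j (u i * v j - u j * v i) ^+ 2
    = \sum_i \sum_j (u i ^+ 2 * v j ^+ 2) + \sum_i \sum_j (v i ^+ 2 * u j ^+ 2)
      - 2 * \sum_i \sum_j ((u i * v i) * (u j * v j)).
  rewrite mulr_sumr -big_split -sumrB; apply: eq_bigr => i _ /=.
  rewrite mulr_sumr -big_split -sumrB; apply: eq_bigr => j _ /=; ring.
have dist (a b : I -> R) : \sum_i \sum_j (a i * b j) = (\sum_i a i) * (\sum_j b j).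
  by rewrite mulr_suml; apply: eq_bigr => i _; rewrite mulr_sumr.
rewrite (dist (fun i => u i ^+ 2) (fun j => v j ^+ 2)).
rewrite (dist (fun i => v i ^+ 2) (fun j => u j ^+ 2)).
rewrite (dist (fun i => u i * v i) (fun j => u j * v j)) expr2.
by move: (\sum_i _) (\sum_i _) (\sum_i _) => A B C; lra.
Qed.

(* Degenerate directions are kept as zero vectors, so that [e] and [phi] share the
   index range. *)
Lemma gram_schmidt {R : realType} (I : finType) (n : nat) (phi : nat -> I -> R) :
  exists e : nat -> I -> R,
  [/\ forall j k, (j < n)%N -> (k < n)%N -> j != k -> \sum_i e j i * e k i = 0,
      forall j, (j < n)%N -> \sum_i e j i ^+ 2 = 1 \/ e j =1 (fun=> 0)
    & forall a : nat -> R, exists c : nat -> R, forall i,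
        \sum_(j < n) a j * phi j i = \sum_(j < n) c j * e j i].
Proof.
elim: n => [|n [e [orth nrm spn]]].
  by exists (fun _ _ => 0); split=> // a; exists a => i; rewrite !big_ord0.
pose dot (u v : I -> R) := \sum_i u i * v i.
pose u i := phi n i - \sum_(j < n) dot (phi n) (e j) * e j i.
have uorth k : (k < n)%N -> dot u (e k) = 0.
  move=> kn; rewrite /dot /u; under eq_bigr do rewrite mulrBl mulr_suml.
  rewrite sumrB exchange_big/= (bigD1 (Ordinal kn))//= [X in _ - (_ + X)]big1 ?addr0; last first.
    move=> j jk; under eq_bigr do rewrite -mulrA.
    by rewrite -mulr_sumr orth ?mulr0// -val_eqE.
  under [X in _ - X]eq_bigr do rewrite -mulrA -expr2.
  rewrite -mulr_sumr -/(dot (phi n) (e k)).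
  have [->|e0] := nrm k kn; first by rewrite mulr1 subrr.
  by rewrite /dot [X in X - _]big1 ?[X in X * _]big1 ?mul0r ?subrr// => i _; rewrite e0 mulr0.
have [u0|u0] := eqVneq (\sum_i u i ^+ 2) 0.
  have uz i : u i = 0.
    move/eqP: u0; rewrite psumr_eq0; last by move=> k _; exact: sqr_ge0.
    by move/allP => /(_ i (mem_index_enum i)); rewrite sqrf_eq0 => /eqP.
  exists (fun k => if k == n then (fun=> 0) else e k); split.
  - move=> j k; rewrite !ltnS => jn kn jk.
    case: eqP => [_|/eqP jn']; first by rewrite big1// => i _; rewrite mul0r.
    case: eqP => [_|/eqP kn']; first by rewrite big1// => i _; rewrite mulr0.
    by apply: orth => //; rewrite ltn_neqAle ?jn' ?kn'.
  - move=> j; rewrite ltnS => jn; case: eqP => [_|/eqP jn']; first by right.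
    by apply: nrm; rewrite ltn_neqAle jn'.
  - move=> a; have [c cE] := spn a.
    exists (fun k => c k + a n * dot (phi n) (e k)) => i.
    rewrite !big_ord_recr/= cE eqxx mulr0 addr0.
    have -> : phi n i = \sum_(j < n) dot (phi n) (e j) * e j i.
      by apply/eqP; rewrite -subr_eq0 -/(u i) uz.
    rewrite mulr_sumr -big_split/=; apply: eq_bigr => j _.
    by rewrite ltn_eqF//; ring.
pose s := Num.sqrt (\sum_i u i ^+ 2).
have s2 : s ^+ 2 = \sum_i u i ^+ 2 by rewrite sqr_sqrtr// sumr_ge0// => i _; exact: sqr_ge0.
have s0 : s != 0 by apply: contra_neq u0 => s0; rewrite -s2 s0 expr0n.
exists (fun k => if k == n then (fun i => u i / s) else e k); split.
- have uk k : (k < n)%N -> \sum_i u i / s * e k i = 0.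
    move=> kn; under eq_bigr do rewrite mulrAC.
    by rewrite -mulr_suml -/(dot u (e k)) uorth// mul0r.
  move=> j k; rewrite !ltnS => jn kn jk.
  case: eqP => [jE|/eqP jn']; case: eqP => [kE|/eqP kn'].
  - by rewrite jE kE eqxx in jk.
  - by apply: uk; rewrite ltn_neqAle kn'.
  - by under eq_bigr do rewrite mulrC; apply: uk; rewrite ltn_neqAle jn'.
  - by apply: orth => //; rewrite ltn_neqAle ?jn' ?kn'.
- move=> j; rewrite ltnS => jn; case: eqP => [_|/eqP jn'].
    left; under eq_bigr do rewrite exprMn.
    by rewrite -mulr_suml -s2 -exprMn divff// expr1n.
  by apply: nrm; rewrite ltn_neqAle jn'.
- move=> a; have [c cE] := spn a.
  exists (fun k => if k == n then a n * s else c k + a n * dot (phi n) (e k)) => i.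
  rewrite !big_ord_recr/= cE eqxx.
  have -> : phi n i = u i + \sum_(j < n) dot (phi n) (e j) * e j i.
    by rewrite /u subrK.
  rewrite [a n * s * _](_ : _ = a n * u i); last by field.
  rewrite mulrDr addrCA addrC; congr (_ + _).
  rewrite mulr_sumr -big_split/=; apply: eq_bigr => j _.
  by rewrite ltn_eqF//; ring.
Qed.

(** The last factor is the squared norm of the projection of [y] onto the span of [phi]. It does not
    depend on [v], so one bound on it controls all vectors of the span at once. *)
Lemma orthonormal_family_dominates {R : realType} (I J : finType) (phi : J -> I -> R) :
  exists e : 'I_#|J| -> I -> R,
  [/\ forall j k, j != k -> \sum_i e j i * e k i = 0,
      forall j, \sum_i e j i ^+ 2 <= 1
    & forall (a : J -> R) (v y : I -> R), (forall i, v i = \sum_j a j * phi j i) ->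
        (\sum_i v i * y i) ^+ 2
        <= (\sum_i v i ^+ 2) * \sum_k (\sum_i e k i * y i) ^+ 2].
Proof.
(* Transports a family indexed by [J] to the natural numbers, with the default [s] beyond [#|J|]. *)
pose ext (S : Type) (s : S) (w : J -> S) (k : nat) : S :=
  if insub k is Some k' then w (enum_val (k' : 'I_#|J|)) else s.
have extE S (s : S) w (k : 'I_#|J|) : ext S s w k = w (enum_val k).
  by rewrite /ext valK.
have [e [orth nrm spn]] := gram_schmidt I #|J| (ext _ (fun=> 0) phi).
exists (fun k => e k); split.
- by move=> j k jk; apply: orth.
- move=> j; have [->//|e0] := nrm j (ltn_ord j).
  by rewrite big1// => i _; rewrite e0 expr0n.
move=> a v y vE.
have [c cE] := spn (ext _ 0 a).
(* [nu k] is 0 or 1. Multiplying by it erases the coefficients along zero directions, without which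
   $\|v\|^2=\sum_k b_k^2$ would fail. *)
pose nu k := \sum_i e k i ^+ 2.
have en (k : 'I_#|J|) i : e k i * nu k = e k i.
  have [|e0] := nrm k (ltn_ord k); first by rewrite /nu => ->; rewrite mulr1.
  by rewrite e0 mul0r.
have nn (k : 'I_#|J|) : nu k ^+ 2 = nu k.
  rewrite /nu; have [->|e0] := nrm k (ltn_ord k); first by rewrite expr1n.
  by rewrite big1 ?expr0n// => i _; rewrite e0 expr0n.
pose b (k : 'I_#|J|) := c k * nu k.
have vb i : v i = \sum_k b k * e k i.
  rewrite vE (reindex (@enum_val _ xpredT))/=; last first.
    by apply: onW_bij; exact: enum_val_bij.
  transitivity (\sum_(j < #|J|) ext _ 0 a j * ext _ (fun=> 0) phi j i).
    by apply: eq_bigr => j _; rewrite !extE.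
  by rewrite cE; apply: eq_bigr => k _; rewrite /b -mulrA [nu _ * _]mulrC en.
have -> : \sum_i v i * y i = \sum_k b k * \sum_i e k i * y i.
  under eq_bigr do rewrite vb mulr_suml.
  rewrite exchange_big; apply: eq_bigr => k _.
  by rewrite mulr_sumr; apply: eq_bigr => i _; rewrite mulrA.
have -> : \sum_i v i ^+ 2 = \sum_k b k ^+ 2.
  under eq_bigr => i _.
    rewrite expr2 [X in X * _]vb mulr_suml.
    under eq_bigr do rewrite vb mulr_sumr.
    over.
  rewrite exchange_big; apply: eq_bigr => k _.
  rewrite exchange_big (bigD1 k)//= [X in _ + X]big1 ?addr0.
    under eq_bigr do rewrite mulrACA -!expr2.
    by rewrite -mulr_sumr -/(nu k) /b exprMn nn -mulrA -expr2 nn.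
  move=> l lk; under eq_bigr do rewrite mulrACA.
  by rewrite -mulr_sumr orth ?mulr0// eq_sym.
exact: cauchy_schwarz_sum.
Qed.

(** The basic inequality of least squares against the competitor [b]. The noise [y - th] is paired
    only with [s - b], a difference of two elements of the fitted space, and [tau] stands for the
    squared norm of the projected noise. *)
Lemma least_squares_error {R : realType} (I : finType) (y th b s : I -> R) (tau : R) :
  \sum_i (y i - s i) ^+ 2 <= \sum_i (y i - b i) ^+ 2 ->
  (\sum_i (s i - b i) * (y i - th i)) ^+ 2 <= (\sum_i (s i - b i) ^+ 2) * tau ->
  0 <= tau ->
  \sum_i (s i - th i) ^+ 2 <= 18 * \sum_i (th i - b i) ^+ 2 + 16 * tau.
Proof.
move=> ls noise tau0.
have approx := cauchy_schwarz_sum I (fun i => s i - b i) (fun i => th i - b i).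
have D0 : 0 <= \sum_i (th i - b i) ^+ 2 by apply: sumr_ge0 => i _; exact: sqr_ge0.
have V0 : 0 <= \sum_i (s i - b i) ^+ 2 by apply: sumr_ge0 => i _; exact: sqr_ge0.
have basic : \sum_i (s i - b i) ^+ 2 <= 2 * \sum_i (s i - b i) * (y i - th i)
    + 2 * \sum_i (s i - b i) * (th i - b i).
  have : \sum_i (y i - s i) ^+ 2 = \sum_i (y i - b i) ^+ 2 + \sum_i (s i - b i) ^+ 2
      - 2 * \sum_i (s i - b i) * (y i - th i) - 2 * \sum_i (s i - b i) * (th i - b i).
    rewrite !mulr_sumr -big_split -!sumrB; apply: eq_bigr => i _ /=; ring.
  by move=> E; rewrite E in ls; lra.
have split : \sum_i (s i - th i) ^+ 2
    <= 2 * \sum_i (s i - b i) ^+ 2 + 2 * \sum_i (th i - b i) ^+ 2.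
  rewrite !mulr_sumr -big_split; apply: ler_sum => i _ /=.
  by have := sqr_ge0 (s i - b i + (th i - b i)); nra.
move: noise approx D0 V0 basic split.
move: (\sum_i (s i - b i) * (y i - th i)) (\sum_i (s i - b i) * (th i - b i)).
move: (\sum_i (s i - b i) ^+ 2) (\sum_i (th i - b i) ^+ 2).
move=> V D W U noise approx D0 V0 basic split.
(* AM-GM: [W ^ 2 <= V t] gives [2 W <= V / 4 + 4 t] *)
have amgm (w t : R) : w ^+ 2 <= V * t -> 0 <= t -> 2 * w <= V / 4 + 4 * t.
  move=> wt t0; rewrite leNgt; apply/negP => lt.
  have : 0 <= V / 4 + 4 * t by rewrite addr_ge0// ?divr_ge0 ?mulr_ge0.
  have := sqr_ge0 (V / 4 - 4 * t).
  by nra.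
(* Each cross term costs $V/4$, so half of $V$ is absorbed: $V\le 8D+8\tau$, and $2V+2D$ gives the
   constants 18 and 16. *)
by have := amgm _ _ noise tau0; have := amgm _ _ approx D0; lra.
Qed.

(** Pigeonhole: otherwise [a] would inject the indices from [i] on into the smaller set of values
    above [i]. *)
Lemma perm_exceeds {d : nat} (a : 'S_d) (i : 'I_d) :
  (i < a i)%N -> exists2 j : 'I_d, (i < j)%N & (a j <= i)%N.
Proof.
move=> iai; apply/exists2P; apply: contrapT => /forallNP noj.
have : a @: [set j : 'I_d | (i <= j)%N]%SET \subset [set v : 'I_d | (i < v)%N]%SET.
  apply/fintype.subsetP => x /imsetP[j]; rewrite inE leq_eqVlt => ij ->; rewrite inE.
  case/predU1P: ij => [/val_inj <-//|ij]; rewrite ltnNge; apply/negP => aji.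
  by apply: (noj j).
move/subset_leq_card; rewrite card_imset; last exact: perm_inj.
apply/negP; rewrite -ltnNge; apply: proper_card; apply/properP; split.
  by apply/fintype.subsetP => j; rewrite !inE; exact: ltnW.
by exists i; rewrite inE ?ltnn.
Qed.

Lemma perm_precedes {d : nat} (a : 'S_d) (i : 'I_d) :
  (a i < i)%N -> exists2 j : 'I_d, (j < i)%N & (i <= a j)%N.
Proof.
move=> iai; apply/exists2P; apply: contrapT => /forallNP noj.
have : a @: [set j : 'I_d | (j <= i)%N]%SET \subset [set v : 'I_d | (v < i)%N]%SET.
  apply/fintype.subsetP => x /imsetP[j]; rewrite inE leq_eqVlt => ij ->; rewrite inE.
  case/predU1P: ij => [/val_inj ->//|ij]; rewrite ltnNge; apply/negP => aji.
  by apply: (noj j).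
move/subset_leq_card; rewrite card_imset; last exact: perm_inj.
apply/negP; rewrite -ltnNge; apply: proper_card; apply/properP; split.
  by apply/fintype.subsetP => j; rewrite !inE; exact: ltnW.
by exists i; rewrite inE ?ltnn.
Qed.

(** If [a i] exceeds [i], some later [j] has [a j] at most [i]. The noisy order then forces
    [g (a i) - g (a j)] below [2 * delta], and inverting the monotonicity bounds [a i - a j], which
    is at least the displacement. The other direction is symmetric. *)
Lemma sorting_displacement {R : realType} (d : nat) (a : 'S_d) (g e : 'I_d -> R)
    (beta C delta : R) :
  0 < beta -> 0 < C ->
  (forall i j : 'I_d, (j <= i)%N ->
     ((i%:R - j%:R) / d%:R) `^ beta^-1 <= C * (g i - g j)) ->
  (forall i j : 'I_d, (i <= j)%N -> g (a i) + e i <= g (a j) + e j) ->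
  (forall i, `|e i| <= delta) ->
  forall i, `|(a i)%:R - i%:R| / d%:R <= (2 * C * delta) `^ beta.
Proof.
move=> b0 C0 gmono sorted ed i.
have gap (p q : 'I_d) : (p <= q)%N -> g q - g p <= 2 * delta ->
    (q%:R - p%:R) / d%:R <= (2 * C * delta) `^ beta.
  move=> pq gpq.
  have pq0 : 0 <= (q%:R - p%:R) / d%:R :> R.
    by rewrite divr_ge0// subr_ge0 ler_nat.
  have := gmono q p pq => h.
  have -> : (q%:R - p%:R) / d%:R = (((q%:R - p%:R) / d%:R) `^ beta^-1) `^ beta :> R.
    by rewrite -powRrM mulVf ?gt_eqF// powRr1.
  have lt : ((q%:R - p%:R) / d%:R) `^ beta^-1 <= 2 * C * delta.
    by apply: le_trans h _; have := ler_wpM2l (ltW C0) gpq; lra.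
  apply: ge0_ler_powR; rewrite ?nnegrE ?powR_ge0//; first exact: ltW.
  exact: le_trans (powR_ge0 _ _) lt.
have close (p q : 'I_d) : (p <= q)%N -> g (a p) - g (a q) <= 2 * delta.
  move=> pq; have := sorted p q pq; have := ed p; have := ed q.
  by rewrite !ler_norml => /andP[? ?] /andP[? ?] ?; lra.
have d0 : 0 < d%:R :> R by rewrite ltr0n (leq_ltn_trans _ (ltn_ord i)).
have [lt|lt|E] := ltngtP i (a i).
- have [j ij aj] := perm_exceeds a i lt.
  rewrite ger0_norm ?subr_ge0 ?ler_nat; last exact: ltnW.
  apply: (@le_trans _ _ (((a i)%:R - (a j)%:R) / d%:R)).
    by rewrite ler_pM2r ?invr_gt0// lerD2l lerN2 ler_nat.
  apply: gap; first exact: leq_trans aj (ltnW lt).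
  by apply: close; exact: ltnW.
- have [j ij aj] := perm_precedes a i lt.
  rewrite ler0_norm ?subr_le0 ?ler_nat ?opprB; last exact: ltnW.
  apply: (@le_trans _ _ (((a j)%:R - (a i)%:R) / d%:R)).
    by rewrite ler_pM2r ?invr_gt0// lerD2r ler_nat.
  apply: gap; first exact: leq_trans (ltnW lt) aj.
  by apply: close; exact: ltnW.
- by rewrite -E subrr normr0 mul0r powR_ge0.
Qed.

(** * Taylor approximation on the cube *)

Lemma near_within_dnbhs0P {R : realType} (D P : set R) :
  (\forall k \near within D (0 : R)^', P k) <->
  exists2 e : R, 0 < e & forall k : R, `|k| < e -> k != 0 -> D k -> P k.
Proof.
split.
  move=> nearP.
  have /nbhs_ballP[e /= e0 He] : nbhs (0 : R) [set k | k != 0 -> D k -> P k] := nearP.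
  by exists e => // k ke; apply: He; rewrite /ball/= sub0r normrN.
move=> [e e0 He].
suff : nbhs (0 : R) [set k | k != 0 -> D k -> P k] by [].
apply/nbhs_ballP; exists e => //= k; rewrite /ball/= sub0r normrN; exact: He.
Qed.

(** The quotients are one-sided at 0 and 1, so the continuity at the ends that the mean value
    theorem asks for has to be drawn from the quotients themselves. *)
Lemma mean_value_unit_itv {R : realType} (phi dphi : R -> R) (B : R) :
  (forall u : R, 0 <= u <= 1 ->
     k^-1 * (phi (u + k) - phi u)
       @[k --> within [set k : R | 0 <= u + k <= 1] (0 : R)^'] --> dphi u) ->
  (forall u : R, 0 <= u <= 1 -> `|dphi u| <= B) ->
  `|phi 1 - phi 0| <= B.
Proof.
move=> quot dphiB.
have lip (u : R) : 0 <= u <= 1 -> exists2 e : R, 0 < e & forall k : R, `|k| < e ->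
    0 <= u + k <= 1 -> `|phi (u + k) - phi u| <= (`|dphi u| + 1) * `|k|.
  move=> u01; have /cvgrPdist_lt/(_ 1 ltr01) := quot u u01.
  move=> /near_within_dnbhs0P[e e0 He].
  exists e => // k ke uk; have [->|k0] := eqVneq k 0.
    by rewrite addr0 subrr !normr0 mulr0.
  have := He k ke k0 uk; rewrite distrC => /ltW/(le_trans (lerB_dist _ _)); rewrite lerBlDr [1 + _]addrC.
  by rewrite normrM normfV mulrC ler_pdivrMr ?normr_gt0.
have interior (u : R) : u \in `]0, 1[ -> is_derive u 1 phi (dphi u).
  rewrite in_itv/= => /andP[u0 u1].
  have cv : k^-1 *: ((phi \o shift u) (k *: 1) - phi u) @[k --> (0 : R)^'] --> dphi u.
    have := quot u; rewrite (ltW u0) (ltW u1) => /(_ isT) /cvgrPdist_lt q.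
    rewrite -[X in _ @[_ --> X] --> _](@withinET _ (0 : R)^').
    apply/cvgrPdist_lt => e' e'0; have /near_within_dnbhs0P[r' r'0 Hr'] := q e' e'0.
    apply/near_within_dnbhs0P.
    exists (Num.min r' (Num.min u (1 - u))); first by rewrite !lt_min r'0 u0 subr_gt0.
    move=> k; rewrite !lt_min => /and3P[kr' ku ku'] k0 _.
    rewrite /= [k *: _](_ : _ = k); last by rewrite /GRing.scale/= mulr1.
    rewrite [k + u]addrC; apply: Hr' => //.
    by move: ku ku'; rewrite !ltr_norml => /andP[? ?] /andP[? ?]; apply/andP; split; lra.
  by apply: DeriveDef; [apply/cvg_ex; exists (dphi u)|exact/cvg_lim].
have cont : {within `[0, 1], continuous phi}.
  apply/continuous_within_itvP => //.
  have side (u : R) : 0 <= u <= 1 ->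
      forall e : R, 0 < e -> exists2 r : R, 0 < r & forall k : R, `|k| < r ->
        0 <= u + k <= 1 -> `|phi u - phi (u + k)| < e.
    move=> u01 e e0; have [r r0 Hr] := lip u u01.
    have A0 : 0 < `|dphi u| + 1 by rewrite ltr_wpDl.
    exists (Num.min r (e / (`|dphi u| + 1))); first by rewrite lt_min r0 divr_gt0.
    move=> k; rewrite lt_min => /andP[kr ke] uk.
    rewrite distrC (le_lt_trans (Hr k kr uk))// mulrC -ltr_pdivlMr//.
  have z01 : 0 <= (0 : R) <= 1 by rewrite lexx ler01.
  have o01 : 0 <= (1 : R) <= 1 by rewrite lexx ler01.
  split.
  - move=> u /interior du; apply: differentiable_continuous; apply/derivable1_diffP.
    exact: ex_derive.
  - apply/cvgrPdist_lt => e e0; have [r r0 Hr] := side 0 z01 e e0.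
    near=> x; have := Hr x; rewrite add0r; apply.
      rewrite ger0_norm; first by near: x; exact: nbhs_right_lt.
      by near: x; exact: nbhs_right_ge.
    apply/andP; split; first by near: x; exact: nbhs_right_ge.
    by near: x; exact: nbhs_right_le.
  - apply/cvgrPdist_lt => e e0; have [r r0 Hr] := side 1 o01 e e0.
    near=> x; have := Hr (x - 1).
    have -> : 1 + (x - 1) = x by ring.
    apply.
      rewrite ler0_norm ?opprB; last by rewrite subr_le0; near: x; exact: nbhs_left_le.
      by rewrite ltrBlDr -ltrBlDl; near: x; apply: nbhs_left_gt; rewrite gtrBl.
    apply/andP; split; first by near: x; exact: nbhs_left_ge.
    by near: x; exact: nbhs_left_le.
have [c + ->] := MVT_segment ler01 interior cont.
by rewrite in_itv/= subr0 mulr1; exact: dphiB.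
Unshelve. all: by end_near.
Qed.

Lemma row_stepE {R : realType} (m : nat) (x : 'rV[R]_m) (t s : 'I_m) (h : R) :
  (x + h *: delta_mx 0 t) 0 s = x 0 s + h * (s == t)%:R.
Proof. by rewrite !mxE eqxx. Qed.

Lemma partial_mean_value {R : realType} (m : nat) (t : 'I_m) (F G : 'rV[R]_m -> R)
    (x : 'rV[R]_m) (h B : R) :
  is_partial_on_cube t F G ->
  (forall u : R, 0 <= u <= 1 -> cube (x + (u * h) *: delta_mx 0 t) /\
     `|G (x + (u * h) *: delta_mx 0 t)| <= B) ->
  `|F (x + h *: delta_mx 0 t) - F x| <= B * `|h|.
Proof.
move=> FG seg.
have [->|h0] := eqVneq h 0.
  by rewrite scale0r addr0 subrr !normr0 mulr0.
pose y u : 'rV[R]_m := x + (u * h) *: delta_mx 0 t.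
have := @mean_value_unit_itv R (fun u => F (y u)) (fun u => h * G (y u)) (B * `|h|).
rewrite /y mul1r mul0r scale0r addr0; apply.
- move=> u u01; have [yc _] := seg u u01.
  have /cvgrPdist_lt FGu := FG _ yc.
  apply/cvgrPdist_lt => e e0.
  have eh0 : 0 < e / `|h| by rewrite divr_gt0 ?normr_gt0.
  have /near_within_dnbhs0P[r r0 Hr] := FGu _ eh0.
  apply/near_within_dnbhs0P; exists (r / `|h|); first by rewrite divr_gt0 ?normr_gt0.
  move=> k kr k0 uk.
  have yk : x + (u * h) *: delta_mx 0 t + (k * h) *: delta_mx 0 t
      = x + ((u + k) * h) *: delta_mx 0 t.
    by rewrite mulrDl scalerDl addrA.
  have := Hr (k * h); rewrite normrM -ltr_pdivlMr ?normr_gt0//= yk.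
  rewrite mulf_neq0// => /(_ kr isT (seg _ uk).1).
  rewrite ltr_pdivlMr ?normr_gt0// -normrM; congr (`|_| < _).
  by field; rewrite k0 h0.
- move=> u u01; rewrite normrM mulrC ler_pM2r ?normr_gt0//.
  by have [] := seg u u01.
Qed.

(** Coordinates are changed one at a time. The intermediate points [y j] and the segments joining
    them stay in the cube and in the box of radius [h] around [x0], so partial derivatives
    suffice. *)
Lemma cube_increment {R : realType} (m : nat) (F : 'rV[R]_m -> R)
    (G : 'I_m -> 'rV[R]_m -> R) (x0 x : 'rV[R]_m) (h B : R) :
  (forall t, is_partial_on_cube t F (G t)) ->
  cube x0 -> cube x -> (forall s, `|x 0 s - x0 0 s| <= h) ->
  (forall t z, cube z -> (forall s, `|z 0 s - x0 0 s| <= h) -> `|G t z| <= B) ->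
  `|F x - F x0| <= m%:R * h * B.
Proof.
move=> FG c0 cx xh GB.
pose y (j : nat) : 'rV[R]_m := \row_s (if (s < j)%N then x 0 s else x0 0 s).
have ym : y m = x by apply/rowP => s; rewrite mxE ltn_ord.
have y0 : y 0%N = x0 by apply/rowP => s; rewrite mxE.
have step (j : 'I_m) : `|F (y j.+1) - F (y j)| <= h * B.
  have yS : y j.+1 = y j + (x 0 j - x0 0 j) *: delta_mx 0 j.
    apply/rowP => s; rewrite row_stepE !mxE ltnS leq_eqVlt.
    have [->|sj] := eqVneq s j; first by rewrite eqxx ltnn /= mulr1 addrC subrK.
    by rewrite (inj_eq val_inj) (negPf sj) mulr0 addr0.
  have zcoord (u : R) s : (y j + (u * (x 0 j - x0 0 j)) *: delta_mx 0 j) 0 s =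
      if (s < j)%N then x 0 s else
        if s == j then x0 0 j + u * (x 0 j - x0 0 j) else x0 0 s.
    rewrite row_stepE !mxE; have [->|sj] := eqVneq s j; first by rewrite ltnn mulr1.
    by rewrite mulr0 addr0.
  have h0 : 0 <= h by apply: le_trans (xh j).
  rewrite yS; apply: le_trans (partial_mean_value m j F (G j) _ _ B (FG j) _) _.
    move=> u /andP[u0 u1].
    have cz : cube (y j + (u * (x 0 j - x0 0 j)) *: delta_mx 0 j).
      move=> s; rewrite zcoord; case: ifP => _; first exact: cx.
      case: eqP => _; last exact: c0.
      have := cx j; have := c0 j => /andP[? ?] /andP[? ?].
      by apply/andP; split; nra.
    split => //; apply: GB => // s; rewrite zcoord; case: ifP => _; first exact: xh.
    case: eqP => [->|_]; last by rewrite subrr normr0.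
    rewrite addrAC subrr add0r normrM ger0_norm//.
    by apply: le_trans (xh j); rewrite ler_piMl.
  rewrite mulrC ler_wpM2r//.
  by apply: le_trans (GB j x0 c0 _) => // s; rewrite subrr normr0.
rewrite -[X in F X - _]ym -[X in _ - F X]y0.
rewrite -(telescope_sumr (fun j => F (y j)) (leq0n m)) big_mkord.
apply: le_trans (ler_norm_sum _ _ _) _.
apply: (@le_trans _ _ (\sum_(j < m) h * B)); first by apply: ler_sum => j _.
by rewrite sumr_const card_ord -[leLHS]mulr_natl mulrA.
Qed.

Lemma partial_ext {R : realType} (m : nat) (t : 'I_m) (F G G' : 'rV[R]_m -> R) :
  is_partial_on_cube t F G -> (forall x, G x = G' x) -> is_partial_on_cube t F G'.
Proof. by move=> FG GG' x cx; rewrite -GG'; exact: FG. Qed.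

Lemma partial_cst {R : realType} (m : nat) (t : 'I_m) (c : R) :
  is_partial_on_cube t (fun _ : 'rV[R]_m => c) (fun=> 0).
Proof.
move=> x cx; under eq_fun do rewrite subrr mulr0.
exact: cvg_cst.
Qed.

Lemma partial_sum {R : realType} (m : nat) (t : 'I_m) (I : Type) (r : seq I)
    (a : I -> R) (F G : I -> 'rV[R]_m -> R) :
  (forall i, is_partial_on_cube t (F i) (G i)) ->
  is_partial_on_cube t (fun x => \sum_(i <- r) a i * F i x)
    (fun x => \sum_(i <- r) a i * G i x).
Proof.
move=> FG; elim: r => [|i r IH] x cx.
  under eq_fun do rewrite !big_nil subrr mulr0.
  by rewrite big_nil; exact: cvg_cst.
rewrite [X in X @ _](_ : _ = (fun h => a i * (h^-1 * (F i (x + h *: delta_mx 0 t) - F i x))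
   + h^-1 * ((\sum_(j <- r) a j * F j (x + h *: delta_mx 0 t))
             - (\sum_(j <- r) a j * F j x)))); last first.
  by apply/funext => h; rewrite !big_cons; ring.
rewrite big_cons; exact: (cvgD (cvgM (cvg_cst (a i)) (FG i x cx)) (IH x cx)).
Qed.

Lemma partial_sub {R : realType} (m : nat) (t : 'I_m) (F G F' G' : 'rV[R]_m -> R) :
  is_partial_on_cube t F F' -> is_partial_on_cube t G G' ->
  is_partial_on_cube t (fun x => F x - G x) (fun x => F' x - G' x).
Proof.
move=> FF' GG' x cx.
rewrite [X in X @ _](_ : _ = (fun h => h^-1 * (F (x + h *: delta_mx 0 t) - F x)
   - h^-1 * (G (x + h *: delta_mx 0 t) - G x))); last first.
  by apply/funext => h; ring.
exact: (cvgB (FF' x cx) (GG' x cx)).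
Qed.

Lemma partial_mul_coord {R : realType} (m : nat) (t u : 'I_m) (c : R)
    (F G : 'rV[R]_m -> R) :
  is_partial_on_cube t F G ->
  is_partial_on_cube t (fun x => (x 0 u - c) * F x)
    (fun x => (x 0 u - c) * G x + (u == t)%:R * F x).
Proof.
move=> FG x cx.
pose D := within [set h | cube (x + h *: delta_mx 0 t)] (0 : R)^'.
pose q h := h^-1 * (F (x + h *: delta_mx 0 t) - F x).
have qG : q h @[h --> D] --> G x by exact: FG.
have idD : h @[h --> D] --> (0 : R).
  apply/cvgrPdist_lt => e e0; apply/near_within_dnbhs0P; exists e => // k ke _ _.
  by rewrite sub0r normrN.
(* [F (x + h e_t)] is written as [F x + h * q h], so that its limit follows from that of the
   quotient [q]. *)
have lim1 : (x 0 u - c) * q h + (u == t)%:R * (F x + h * q h) @[h --> D]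
    --> (x 0 u - c) * G x + (u == t)%:R * F x.
  rewrite -[X in (u == t)%:R * X](addr0 (F x)) -[X in F x + X](mul0r (G x)).
  apply: cvgD; first by apply: cvgM => //; exact: cvg_cst.
  apply: cvgM; first exact: cvg_cst.
  by apply: cvgD; [exact: cvg_cst|exact: cvgM].
apply: cvg_trans lim1; apply: near_eq_cvg.
apply/near_within_dnbhs0P; exists 1 => // h _ h0 _.
rewrite row_stepE /q; set Fh := F _.
by field.
Qed.

(* [taylor_form D x0 r kappa] is the sum over (t_1, ..., t_r) of
   D_(kappa + e_(t_1) + ... + e_(t_r)) x0 times the product of the
   x_(t_i) - x0_(t_i); indexing by sequences of directions rather than by
   multi-indices makes differentiation shift [kappa] without combinatorics. *)
Fixpoint taylor_form {R : realType} {m : nat} (D : multinom m -> 'rV[R]_m -> R)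
    (x0 : 'rV[R]_m) (r : nat) (kappa : multinom m) (x : 'rV[R]_m) : R :=
  if r is r'.+1 then
    \sum_t (x 0 t - x0 0 t) * taylor_form D x0 r' (mnm_add kappa (mnm1 t)) x
  else D kappa x0.

(** The forms run over ordered directions: a multi-index $\kappa$ of degree $r$ arises from
    $r!/\kappa!$ sequences, and the weight $1/r!$ restores the usual $1/\kappa!$. *)
Definition taylor_sum {R : realType} {m : nat} (D : multinom m -> 'rV[R]_m -> R)
    (x0 : 'rV[R]_m) (l : nat) (kappa : multinom m) (x : 'rV[R]_m) : R :=
  \sum_(r < l.+1) (r`!%:R)^-1 * taylor_form D x0 r kappa x.

(** The [r] coordinate factors contribute equally by symmetry. At [r = 0] the coefficient vanishes,
    so the value of [r.-1] is immaterial. *)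
Lemma taylor_form_partial {R : realType} (m : nat) (D : multinom m -> 'rV[R]_m -> R)
    (x0 : 'rV[R]_m) (r : nat) (kappa : multinom m) (t : 'I_m) :
  is_partial_on_cube t (taylor_form D x0 r kappa)
    (fun x => r%:R * taylor_form D x0 r.-1 (mnm_add kappa (mnm1 t)) x).
Proof.
elim: r kappa => [|r IH] kappa.
  by apply: (partial_ext m t _ _ _ (partial_cst m t (D kappa x0))) => x; rewrite mul0r.
pose F u (x : 'rV[R]_m) := (x 0 u - x0 0 u) * taylor_form D x0 r (mnm_add kappa (mnm1 u)) x.
pose G u (x : 'rV[R]_m) := (x 0 u - x0 0 u) *
    (r%:R * taylor_form D x0 r.-1 (mnm_add (mnm_add kappa (mnm1 u)) (mnm1 t)) x)
    + (u == t)%:R * taylor_form D x0 r (mnm_add kappa (mnm1 u)) x.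
have FG u : is_partial_on_cube t (F u) (G u) by exact: partial_mul_coord.
have := partial_sum m t _ (index_enum 'I_m) (fun=> 1) F G FG.
have -> : (fun x => \sum_u 1 * F u x) = taylor_form D x0 r.+1 kappa.
  by apply/funext => x; apply: eq_bigr => u _; rewrite mul1r.
move=> /partial_ext; apply => x.
under eq_bigr do rewrite mul1r.
have diag : \sum_u (u == t)%:R * taylor_form D x0 r (mnm_add kappa (mnm1 u)) x
    = taylor_form D x0 r (mnm_add kappa (mnm1 t)) x.
  rewrite (bigD1 t)//= eqxx mul1r big1 ?addr0// => u /negPf ->.
  by rewrite mul0r.
rewrite big_split/= diag.
case: r {IH F G FG diag} => [|r].
  by rewrite mul1r big1 ?add0r// => u _; rewrite mul0r mulr0.
rewrite -(natr1 r.+1) mulrDl mul1r; congr (_ + _).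
rewrite /= mulr_sumr; apply: eq_bigr => u _.
(* Symmetry of mixed partials is built into the indexing of [D] and shows up as commutativity of
   [mnm_add]. *)
by rewrite mulrCA -!mpoly.addmA [mnm_add (mnm1 u) _]mpoly.addmC.
Qed.

Lemma taylor_sum_partial {R : realType} (m : nat) (D : multinom m -> 'rV[R]_m -> R)
    (x0 : 'rV[R]_m) (l : nat) (kappa : multinom m) (t : 'I_m) :
  is_partial_on_cube t (taylor_sum D x0 l.+1 kappa)
    (taylor_sum D x0 l (mnm_add kappa (mnm1 t))).
Proof.
have := partial_sum m t _ (index_enum 'I_l.+2) (fun r => (r`!%:R)^-1)
  (fun r => taylor_form D x0 r kappa) _ (fun r => taylor_form_partial m D x0 r kappa t).
move=> /partial_ext; apply => x.
rewrite big_ord_recl/= mul0r mulr0 add0r; apply: eq_bigr => r _.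
rewrite /= /bump/= add1n factS natrM invfM mulrA; congr (_ * _).
by rewrite mulrAC mulVf ?mul1r// pnatr_eq0.
Qed.

Lemma taylor_sum_center {R : realType} (m : nat) (D : multinom m -> 'rV[R]_m -> R)
    (x0 : 'rV[R]_m) (l : nat) (kappa : multinom m) :
  taylor_sum D x0 l kappa x0 = D kappa x0.
Proof.
rewrite /taylor_sum big_ord_recl/= fact0 invr1 mul1r big1 ?addr0// => r _.
by rewrite /= big1 ?mulr0// => t _; rewrite subrr mul0r.
Qed.

(** The remainder vanishes at [x0] and its partial derivatives are remainders of one order less, so
    each induction step gains a factor $mh$ from [cube_increment]. *)
Lemma taylor_remainder {R : realType} (m s : nat) (f : 'rV[R]_m -> R)
    (D : multinom m -> 'rV[R]_m -> R) (x0 : 'rV[R]_m) (h W : R) (l : nat)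
    (kappa : multinom m) :
  partials_upto s f D -> (mdeg kappa + l <= s)%N -> cube x0 ->
  (forall mu z, mdeg mu = (mdeg kappa + l)%N -> cube z ->
     (forall t, `|z 0 t - x0 0 t| <= h) -> `|D mu z - D mu x0| <= W) ->
  forall x, cube x -> (forall t, `|x 0 t - x0 0 t| <= h) ->
    `|D kappa x - taylor_sum D x0 l kappa x| <= (m%:R * h) ^+ l * W.
Proof.
move=> [_ fD]; elim: l kappa => [|l IH] kappa ls c0 DW x cx xh.
  rewrite /taylor_sum big_ord1 fact0 invr1 !mul1r; apply: DW => //.
  by rewrite addn0.
have := cube_increment m (fun x => D kappa x - taylor_sum D x0 l.+1 kappa x)
  (fun t x => D (mnm_add kappa (mnm1 t)) x
              - taylor_sum D x0 l (mnm_add kappa (mnm1 t)) x)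
  x0 x h ((m%:R * h) ^+ l * W).
rewrite taylor_sum_center subrr subr0 exprS mulrA; apply => //.
- move=> t; apply: partial_sub; last exact: taylor_sum_partial.
  by apply: fD; apply: leq_trans ls; rewrite addnS ltnS leq_addr.
- move=> t z cz zh; have dt : mdeg (mnm_add kappa (mnm1 t)) = (mdeg kappa).+1.
    by rewrite mpoly.mdegD mpoly.mdeg1 addn1.
  by apply: IH => //; rewrite dt addSnnS//.
Qed.

(** The rescaling by [c], later [d%:R], passes from cube coordinates to the integer indices in which
    [block_poly] wants its polynomials. *)
Lemma taylor_form_poly {R : realType} (m : nat) (D : multinom m -> 'rV[R]_m -> R)
    (x0 : 'rV[R]_m) (c : R) (r : nat) (kappa : multinom m) :
  exists2 p : mpoly m R, (msize p <= r.+1)%N &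
    forall v : 'I_m -> R, taylor_form D x0 r kappa (\row_t (v t / c)) = meval v p.
Proof.
elim: r kappa => [|r IH] kappa.
  exists (mpolyC m (D kappa x0)); first by rewrite mpoly.msizeC leq_b1.
  by move=> v; rewrite mpoly.mevalC.
have [p pE] : {p : 'I_m -> mpoly m R & forall t, (msize (p t) <= r.+1)%N /\
    forall v : 'I_m -> R, taylor_form D x0 r (mnm_add kappa (mnm1 t)) (\row_t (v t / c))
      = meval v (p t)}.
  apply: (@choice _ _ (fun t q => (msize q <= r.+1)%N /\
    forall v : 'I_m -> R, taylor_form D x0 r (mnm_add kappa (mnm1 t)) (\row_t (v t / c))
      = meval v q)) => t.
  by have [p ? ?] := IH (mnm_add kappa (mnm1 t)); exists p.
pose q t : mpoly m R := c^-1 *: mpolyX R (mnm1 t) - mpolyC m (x0 0 t).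
have qs t : (msize (q t) <= 2)%N.
  rewrite /q -mpoly.mpolyCN.
  apply: (leq_trans (mpoly.msizeD_le _ _)); rewrite geq_max; apply/andP; split.
    by apply: (leq_trans (mpoly.msizeZ_le _ _)); rewrite mpoly.msizeX mpoly.mdeg1.
  by rewrite mpoly.msizeC; apply: leq_trans (leq_b1 _) _.
exists (\sum_t q t * p t).
  apply: (leq_trans (mpoly.msize_sum _ _ _)); apply/bigmax_leqP => t _.
  have [->|q0] := eqVneq (q t) 0; first by rewrite mul0r mpoly.msize0.
  have [->|p0] := eqVneq (p t) 0; first by rewrite mulr0 mpoly.msize0.
  by rewrite mpoly.msizeM// -subn1 leq_subLR; exact: leq_add (qs t) (pE t).1.
move=> v; rewrite raddf_sum/=; apply: eq_bigr => t _.
rewrite mpoly.mevalM -(pE t).2 /q mpoly.mevalB mpoly.mevalZ mpoly.mevalXU mpoly.mevalC.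
by rewrite mxE [_^-1 * _]mulrC.
Qed.

Lemma taylor_sum_poly {R : realType} (m : nat) (D : multinom m -> 'rV[R]_m -> R)
    (x0 : 'rV[R]_m) (c : R) (l : nat) (kappa : multinom m) :
  exists2 p : mpoly m R, (msize p <= l.+1)%N &
    forall v : 'I_m -> R, taylor_sum D x0 l kappa (\row_t (v t / c)) = meval v p.
Proof.
have [p pE] : {p : nat -> mpoly m R & forall r, (msize (p r) <= r.+1)%N /\
    forall v : 'I_m -> R, taylor_form D x0 r kappa (\row_t (v t / c)) = meval v (p r)}.
  apply: (@choice _ _ (fun r q => (msize q <= r.+1)%N /\
    forall v : 'I_m -> R, taylor_form D x0 r kappa (\row_t (v t / c)) = meval v q)) => r.
  by have [p ? ?] := taylor_form_poly m D x0 c r kappa; exists p.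
exists (\sum_(r < l.+1) (r`!%:R)^-1 *: p r).
  apply: (leq_trans (mpoly.msize_sum _ _ _)); apply/bigmax_leqP => r _.
  apply: (leq_trans (mpoly.msizeZ_le _ _)); apply: (leq_trans (pE r).1).
  by rewrite ltnS -ltnS.
move=> v; rewrite raddf_sum/=; apply: eq_bigr => r _.
by rewrite mpoly.mevalZ (pE r).2.
Qed.

Lemma rV_norm_le {R : realType} (m : nat) (x : 'rV[R]_m) (h : R) :
  0 <= h -> (forall t, `|x 0 t| <= h) -> `|x| <= h.
Proof.
move=> h0 xh; have -> : `|x| = mx_norm x by [].
by rewrite mx_normrE; apply/bigmax_leP; split => // -[i t] _; rewrite /= ord1.
Qed.

Lemma holder_order_itv {R : realType} (alpha : R) : 0 < alpha ->
  (holder_order alpha)%:R < alpha <= (holder_order alpha)%:R + 1.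
Proof.
move=> a0; have sE := holder_orderE a0.
set s := holder_order alpha in sE *; apply/andP; split.
  have : (s%:Z - 1 < Num.ceil (alpha - 1))%R by rewrite -sE ltrBlDr ltrDl.
  by rewrite ceil_gt_int intrB /= ltrD2r.
have : (Num.ceil (alpha - 1) <= s%:Z)%R by rewrite -sE.
by rewrite ceil_le_int lerBlDr.
Qed.

(** Descending induction on the order. At the top order this is the Hölder condition; below it, the
    partials of the next order are bounded on the cube, which gives a Lipschitz bound and the
    exponent 1. *)
Lemma holder_partials_modulus {R : realType} (m : nat) (L alpha : R)
    (f : 'rV[R]_m -> R) (D : multinom m -> 'rV[R]_m -> R) (l : nat) :
  let s := holder_order alpha in
  0 < alpha -> 0 <= L -> partials_upto s f D ->
  (forall x x0, cube x -> cube x0 ->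
      \sum_(kappa : bmultinom m s.+1 | mdeg kappa == s)
         (\prod_(t < m) (kappa t)`!)%:R^-1 * `|D kappa x - D kappa x0|
      <= L * `|x - x0| `^ (alpha - s%:R)) ->
  (l <= s)%N ->
  exists2 A : R, 0 <= A & forall kappa x y (h : R), mdeg kappa = l -> cube x -> cube y ->
    (forall t, `|x 0 t - y 0 t| <= h) -> 0 <= h ->
    `|D kappa x - D kappa y| <= A * h `^ Num.min 1 (alpha - l%:R).
Proof.
move=> s a0 L0 [_ fD] DL ls; have /andP[sa as1] := holder_order_itv _ a0.
rewrite -/s in sa as1.
rewrite -(subKn ls); have := leq_subr l s; move: (s - l)%N => n.
elim: n => [_|n IH ns].
  rewrite subn0; have -> : Num.min 1 (alpha - s%:R) = alpha - s%:R.
    by apply/min_idPr; rewrite lerBlDr addrC.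
  (* An upper bound for $\kappa!$, to undo the weight $1/\kappa!$ of the Hölder condition uniformly
     in $\kappa$. *)
  pose K : R := ((s`!) ^ m)%:R.
  have K0 : 0 < K by rewrite ltr0n expn_gt0 fact_gt0.
  exists (K * L); first by rewrite mulr_ge0// ltW.
  move=> kappa x y h ks cx cy xh h0.
  have kb : (mdeg kappa < s.+1)%N by rewrite ks.
  have bound : (\prod_(t < m) (kappa t)`!)%:R^-1 * `|D kappa x - D kappa y|
      <= L * `|x - y| `^ (alpha - s%:R).
    apply: le_trans (DL x y cx cy).
    rewrite (bigD1 (BMultinom kb))/=; last by rewrite ks.
    by rewrite lerDl; apply: sumr_ge0 => mu _; rewrite mulr_ge0// invr_ge0 ler0n.
  rewrite -mulrA -ler_pdivrMl//.
  apply: (@le_trans _ _ (L * `|x - y| `^ (alpha - s%:R))); last first.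
    rewrite ler_wpM2l//; apply: ge0_ler_powR; rewrite ?nnegrE//.
      by rewrite subr_ge0 ltW.
    by apply: rV_norm_le => // t; rewrite !mxE.
  apply: le_trans bound; rewrite ler_wpM2r// lef_pV2 ?posrE//; last first.
    by rewrite ltr0n prodn_gt0// => t; rewrite fact_gt0.
  rewrite ler_nat.
  have -> : ((s`!) ^ m = \prod_(t < m) s`!)%N by rewrite prod_nat_const card_ord.
  apply: leq_prod => t _; rewrite leq_fact//.
  by rewrite -ks mpoly.mdegE (bigD1 t)//= leq_addr.
have [A A0 HA] := IH (ltnW ns).
have lS : ((s - n) = (s - n.+1).+1)%N by rewrite subnSK.
(* Values at the origin: added to the modulus over distance 1, they bound the partials on the whole
   cube. *)
pose B := \sum_(kappa : bmultinom m s.+1) `|D kappa 0|.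
have B0 : 0 <= B by apply: sumr_ge0.
have c0 : cube (0 : 'rV[R]_m) by move=> t; rewrite mxE lexx ler01.
have bnd kappa z : mdeg kappa = (s - n)%N -> cube z -> `|D kappa z| <= B + A.
  move=> kn cz.
  have kb : (mdeg kappa < s.+1)%N by rewrite kn ltnS leq_subr.
  have DB : `|D kappa 0| <= B.
    by rewrite /B (bigD1 (BMultinom kb))//= lerDl sumr_ge0.
  have := HA kappa z 0 1 kn cz c0; rewrite powR1 mulr1 => /(_ _ ler01) DA.
  rewrite -(subrK (D kappa 0) (D kappa z)) addrC.
  apply: (le_trans (ler_normD _ _)); rewrite lerD// DA// => t.
  by rewrite mxE subr0 ger0_norm; have /andP[] := cz t.
exists (m%:R * (B + A)); first by rewrite mulr_ge0// addr_ge0.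
move=> kappa x y h kl cx cy xh h0.
have -> : Num.min 1 (alpha - (s - n.+1)%:R) = 1.
  apply/min_idPl; rewrite lerBrDr.
  have : (s - n.+1).+1%:R <= s%:R :> R by rewrite ler_nat -lS leq_subr.
  by rewrite -natr1; lra.
rewrite powRr1//.
rewrite [leRHS](_ : _ = m%:R * h * (B + A)); last by ring.
apply: (cube_increment m (D kappa) (fun t => D (mnm_add kappa (mnm1 t)))) => //.
  move=> t; apply: fD; rewrite kl -ltnS -lS ltnS leq_subr//.
move=> t z cz _; apply: bnd => //.
by rewrite mpoly.mdegD mpoly.mdeg1 kl addn1 lS.
Qed.

Lemma holder_continuity_modulus {R : realType} (m : nat) (L alpha : R)
    (f : 'rV[R]_m -> R) :
  0 < alpha -> 0 <= L -> holder alpha L f ->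
  exists2 A : R, 0 <= A & forall x y (h : R), cube x -> cube y ->
    (forall t, `|x 0 t - y 0 t| <= h) -> 0 <= h ->
    `|f x - f y| <= A * h `^ Num.min alpha 1.
Proof.
move=> a0 L0 [D fD DL].
have [A A0 HA] := holder_partials_modulus m L alpha f D 0 a0 L0 fD DL (leq0n _).
exists A => // x y h cx cy xh h0.
have [fE _] := fD; rewrite -!fE//.
have := HA mnm0 x y h; rewrite subr0 minC; apply => //.
by rewrite mpoly.mdeg0.
Qed.

(** [p] is chosen before [h] and [v], so one polynomial serves a whole block. The exponents add up
    as $l+\min(1,\alpha-l)=\min(\alpha,l+1)$. *)
Lemma holder_polynomial_approx {R : realType} (m : nat) (L alpha : R)
    (f : 'rV[R]_m -> R) (l : nat) :
  0 < alpha -> 0 <= L -> holder alpha L f -> (l <= holder_order alpha)%N ->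
  exists2 A : R, 0 <= A & forall x0 c, cube x0 ->
    exists2 p : mpoly m R, (msize p <= l.+1)%N &
    forall (h : R) (v : 'I_m -> R), 0 <= h -> cube (\row_t (v t / c)) ->
      (forall t, `|v t / c - x0 0 t| <= h) ->
      `|f (\row_t (v t / c)) - meval v p| <= A * h `^ Num.min alpha (l%:R + 1).
Proof.
move=> a0 L0 [D fD DL] ls.
have [A A0 HA] := holder_partials_modulus m L alpha f D l a0 L0 fD DL ls.
exists (m%:R ^+ l * A); first by rewrite mulr_ge0// exprn_ge0.
move=> x0 c c0; have [p pl pE] := taylor_sum_poly m D x0 c l mnm0.
exists p => // h v h0 cx xh; rewrite -pE.
have [fE _] := fD; rewrite -fE//.
have d0 : mdeg (mnm0 : multinom m) = 0%N by rewrite mpoly.mdeg0.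
apply: (@le_trans _ _ ((m%:R * h) ^+ l * (A * h `^ Num.min 1 (alpha - l%:R)))).
  apply: (taylor_remainder m _ f D x0 h _ l mnm0 fD) => //.
  - by rewrite d0 add0n.
  - by move=> mu z; rewrite d0 add0n => mul cz zh; exact: HA.
  - by move=> t; rewrite mxE.
rewrite exprMn -!mulrA ler_wpM2l ?exprn_ge0// mulrCA ler_wpM2l//.
have [->|hn0] := eqVneq h 0.
  have la : 0 < Num.min 1 (alpha - l%:R).
    rewrite lt_min ltr01 subr_gt0.
    have /andP[sa _] := holder_order_itv _ a0; apply: le_lt_trans sa.
    by rewrite ler_nat.
  by rewrite powR0 ?gt_eqF// mulr0 powR_ge0.
rewrite -powR_mulrn// -powRD; last by rewrite hn0 implybT.
rewrite le_eqVlt; apply/orP; left; apply/eqP; congr (_ `^ _).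
by rewrite minC addr_minr addrC subrK.
Qed.

(** * Block-wise polynomial tensors *)

Lemma block_labelE {d k : nat} (i : 'I_d) (j : nat) :
  (block_label k i == j.+1%:Z) = (j * d < k * i.+1 <= j.+1 * d)%N.
Proof.
have d0 : 0 < d%:R :> rat by rewrite ltr0n (leq_ltn_trans _ (ltn_ord i)).
rewrite eq_le andbC /block_label ceil_le_int ler_pdivrMr// -natrM ler_nat.
congr (_ && _).
have -> : (j.+1%:Z <= Num.ceil ((k * i.+1)%:R / d%:R : rat))
    = (j%:Z < Num.ceil ((k * i.+1)%:R / d%:R : rat)) by rewrite -lezD1 addrC -intS.
by rewrite ceil_gt_int ltr_pdivlMr// -natrM ltr_nat.
Qed.

(** The label minus one, in natural numbers: $\lceil n/d\rceil-1=\lfloor(n-1)/d\rfloor$ for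
    $n>0$. *)
Definition block_index (d k : nat) (i : 'I_d) : nat := (k * i.+1).-1 %/ d.

Lemma block_label_index {d k : nat} (i : 'I_d) (j : nat) : (0 < k)%N ->
  (block_label k i == j.+1%:Z) = (block_index d k i == j).
Proof.
move=> k0; rewrite block_labelE /block_index.
have d0 : (0 < d)%N by rewrite (leq_ltn_trans _ (ltn_ord i)).
have ki0 : (0 < k * i.+1)%N by rewrite muln_gt0 k0.
have hi : (((k * i.+1).-1 %/ d) <= j)%N = (k * i.+1 <= j.+1 * d)%N.
  by rewrite -ltnS ltn_divLR// prednK.
have lo : (j <= (k * i.+1).-1 %/ d)%N = (j * d < k * i.+1)%N.
  by rewrite leq_divRL// -ltnS prednK.
by rewrite eqn_leq hi lo andbC.
Qed.

Lemma block_index_lt {d k : nat} (i : 'I_d) : (0 < k)%N -> (block_index d k i < k)%N.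
Proof.
move=> k0; rewrite /block_index ltn_divLR; last by rewrite (leq_ltn_trans _ (ltn_ord i)).
by rewrite prednK ?muln_gt0 ?k0// leq_mul2l ltn_ord orbT.
Qed.

Lemma block_coord_close {R : realType} {d k : nat} (i : 'I_d) : (0 < k)%N ->
  `|i.+1%:R / d%:R - (block_index d k i)%:R / k%:R| <= k%:R^-1 :> R.
Proof.
move=> k0; have := block_label_index i (block_index d k i) k0.
rewrite eqxx block_labelE => /andP[lo hi].
have d0 : 0 < d%:R :> R by rewrite ltr0n (leq_ltn_trans _ (ltn_ord i)).
have kR0 : 0 < k%:R :> R by rewrite ltr0n.
have lo' : (block_index d k i)%:R / k%:R <= i.+1%:R / d%:R :> R.
  by rewrite ler_pdivrMr// mulrAC ler_pdivlMr// -!natrM ler_nat [(i.+1 * _)%N]mulnC ltnW.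
rewrite ger0_norm ?subr_ge0// lerBlDl.
have -> : (block_index d k i)%:R / k%:R + k%:R^-1 = (block_index d k i).+1%:R / k%:R :> R.
  by rewrite -natr1 mulrDl mul1r.
by rewrite ler_pdivrMr// mulrAC ler_pdivlMr// -!natrM ler_nat [(i.+1 * _)%N]mulnC.
Qed.

Definition block_of {m d k : nat} (k0 : (0 < k)%N) (w : m.-tuple 'I_d) : m.-tuple 'I_k :=
  map_tuple (fun i => Ordinal (block_index_lt i k0)) w.

Lemma mem_block {m d k : nat} (k0 : (0 < k)%N) (w : m.-tuple 'I_d) (j : m.-tuple 'I_k) :
  (w \in block d j) = (j == block_of k0 w).
Proof.
rewrite inE; apply/forallP/eqP => [wj|-> t].
  apply: eq_from_tnth => t; rewrite tnth_map; apply: val_inj => /=.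
  by apply/esym/eqP; rewrite -block_label_index//; exact: wj.
by rewrite tnth_map block_label_index.
Qed.

Lemma sample_point_cube {R : realType} {m d : nat} (w : m.-tuple 'I_d) :
  cube (\row_t ((tnth w t).+1%:R / d%:R) : 'rV[R]_m).
Proof.
move=> t; rewrite mxE divr_ge0//=.
have d0 : (0 < d)%N by rewrite (leq_ltn_trans _ (ltn_ord (tnth w t))).
by rewrite ler_pdivrMr ?ltr0n// mul1r ler_nat ltn_ord.
Qed.

Lemma block_poly_approx {R : realType} (m : nat) (L alpha : R) (f : 'rV[R]_m -> R)
    (l : nat) :
  0 < alpha -> 0 <= L -> holder alpha L f -> (l <= holder_order alpha)%N ->
  exists2 A : R, 0 <= A & forall d k, (0 < k)%N ->
    exists2 B : tensor R m d, block_poly k l B &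
      forall w, `|sample f w - B w| <= A * k%:R^-1 `^ Num.min alpha (l%:R + 1).
Proof.
move=> a0 L0 hf ls; have [A A0 HA] := holder_polynomial_approx m L alpha f l a0 L0 hf ls.
exists A => // d k k0.
(* The expansion is centred at the lower corner of the block, a point that exists even when the
   block contains no index. *)
pose corner (j : m.-tuple 'I_k) : 'rV[R]_m := \row_t ((tnth j t)%:R / k%:R).
have ccube j : cube (corner j).
  move=> t; rewrite mxE divr_ge0//= ler_pdivrMr ?ltr0n// mul1r ler_nat.
  exact: ltnW.
have [p pE] : {p : m.-tuple 'I_k -> mpoly m R & forall j, (msize (p j) <= l.+1)%N /\
    forall (h : R) (v : 'I_m -> R), 0 <= h -> cube (\row_t (v t / d%:R)) ->
      (forall t, `|v t / d%:R - corner j 0 t| <= h) ->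
      `|f (\row_t (v t / d%:R)) - meval v (p j)| <= A * h `^ Num.min alpha (l%:R + 1)}.
  apply: (@choice _ _ (fun j q => (msize q <= l.+1)%N /\
    forall (h : R) (v : 'I_m -> R), 0 <= h -> cube (\row_t (v t / d%:R)) ->
      (forall t, `|v t / d%:R - corner j 0 t| <= h) ->
      `|f (\row_t (v t / d%:R)) - meval v q| <= A * h `^ Num.min alpha (l%:R + 1))) => j.
  by have [q ? ?] := HA (corner j) d%:R (ccube j); exists q.
exists (fun w : m.-tuple 'I_d => meval (fun t => (tnth w t).+1%:R) (p (block_of k0 w))).
  move=> j; exists (p j); first exact: (pE j).1.
  by move=> w; rewrite (mem_block k0) => /eqP <-.
move=> w; apply: ((pE (block_of k0 w)).2 _ (fun t => (tnth w t).+1%:R)).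
- by rewrite invr_ge0.
- exact: sample_point_cube.
- by move=> t; rewrite mxE tnth_map; exact: block_coord_close.
Qed.

Definition block_monomial {R : realType} {m d k l : nat}
    (jk : m.-tuple 'I_k * bmultinom m l.+1) (w : m.-tuple 'I_d) : R :=
  (w \in block d jk.1)%:R * \prod_t (tnth w t).+1%:R ^+ (bmnm jk.2 t).

Lemma block_poly_span {R : realType} (m d k l : nat) (B : tensor R m d) :
  (0 < k)%N -> block_poly k l B ->
  exists a : m.-tuple 'I_k * bmultinom m l.+1 -> R,
    forall w, B w = \sum_jk a jk * block_monomial jk w.
Proof.
move=> k0 polyB.
have [p pE] : {p : m.-tuple 'I_k -> mpoly m R & forall j, (msize (p j) <= l.+1)%N /\
    forall w, w \in block d j -> B w = meval (fun t => (tnth w t).+1%:R) (p j)}.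
  apply: (@choice _ _ (fun j q => (msize q <= l.+1)%N /\
    forall w, w \in block d j -> B w = meval (fun t => (tnth w t).+1%:R) q)) => j.
  by have [q ? ?] := polyB j; exists q.
exists (fun jk => mcoeff (bmnm jk.2) (p jk.1)) => w.
rewrite -(pair_bigA _ (fun j kappa => mcoeff (bmnm kappa) (p j) *
  block_monomial (l := l) (j, kappa) w))/=.
rewrite (bigD1 (block_of k0 w))//= [X in _ + X]big1 ?addr0; last first.
  move=> j jw; rewrite big1// => kappa _.
  by rewrite /block_monomial/= (mem_block k0) (negPf jw) mul0r mulr0.
have wb : w \in block d (block_of k0 w) by rewrite (mem_block k0).
rewrite ((pE _).2 _ wb) [in LHS](mpoly.mpolywE (pE (block_of k0 w)).1) raddf_sum/=.
apply: eq_bigr => kappa _.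
by rewrite mpoly.mevalZ mpoly.mevalX /block_monomial/= wb mul1r.
Qed.

(** The size of the family counts the spanning monomials, one set for each block; for fixed [m] and
    [l] it is the source of the $k^m$ term. *)
Lemma block_poly_dominating_family {R : realType} (m d k l : nat) : (0 < k)%N ->
  exists e : 'I_(k ^ m * #|{: bmultinom m l.+1}|) -> m.-tuple 'I_d -> R,
  [/\ forall j j', j != j' -> \sum_w e j w * e j' w = 0,
      forall j, \sum_w e j w ^+ 2 <= 1
    & forall (B B' : tensor R m d) (y : m.-tuple 'I_d -> R),
        block_poly k l B -> block_poly k l B' ->
        (\sum_w (B w - B' w) * y w) ^+ 2
        <= (\sum_w (B w - B' w) ^+ 2) * \sum_j (\sum_w e j w * y w) ^+ 2].
Proof.
move=> k0.
have := orthonormal_family_dominates (R := R) (m.-tuple 'I_d)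
  (m.-tuple 'I_k * bmultinom m l.+1)%type (fun jk w => block_monomial jk w).
rewrite card_prod card_tuple card_ord => -[e [orth nrm dom]].
exists e; split => // B B' y /(block_poly_span _ _ _ _ _ k0)[a aE].
move=> /(block_poly_span _ _ _ _ _ k0)[a' aE'].
apply: (dom (fun jk => a jk - a' jk)) => w.
by rewrite aE aE' -sumrB; apply: eq_bigr => jk _; rewrite mulrBl.
Qed.

(** * The error on the good event *)

Lemma map_tuple_permK {m d : nat} (p : 'S_d) :
  cancel (fun w : m.-tuple 'I_d => map_tuple p w) (fun w => map_tuple (p^-1)%g w).
Proof. by move=> w; apply: eq_from_tnth => t; rewrite !tnth_map permK. Qed.

Lemma map_tuple_permKV {m d : nat} (p : 'S_d) :
  cancel (fun w : m.-tuple 'I_d => map_tuple (p^-1)%g w) (fun w => map_tuple p w).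
Proof. by move=> w; apply: eq_from_tnth => t; rewrite !tnth_map permKV. Qed.

Lemma map_tuple_perm_bij {m d : nat} (p : 'S_d) :
  bijective (fun w : m.-tuple 'I_d => map_tuple p w).
Proof. by exists (fun w => map_tuple (p^-1)%g w); [exact: map_tuple_permK|exact: map_tuple_permKV]. Qed.

Lemma score_signal_noise {R : realType} {m d : nat} (Th E : tensor R m d) (p : 'S_d)
    (i : 'I_d) :
  score (fun w => tpermute Th p w + E w) i = score Th (p i) + score E i.
Proof.
rewrite /score big_split mulrDr; congr (_ * _ + _).
rewrite [RHS](reindex (fun w => map_tuple p w))/=; last first.
  by apply: onW_bij; exact: map_tuple_perm_bij.
apply: eq_bigl => w; case: w => -[|j w] wm //=.
by apply/eqP/eqP => -[]; [move=> ->|move=> /perm_inj ->].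
Qed.

(** Moves the error to the sorted coordinates, in which the least-squares problem is posed. *)
Lemma mse_tpermute {R : realType} {m d : nat} (T Th : tensor R m d) (q p : 'S_d) :
  mse (tpermute T q) (tpermute Th p) = (d%:R ^+ m)^-1 *
    \sum_w (T w - Th (map_tuple p (map_tuple (q^-1)%g w))) ^+ 2.
Proof.
rewrite /mse /frob sqr_sqrtr; last by apply: sumr_ge0 => w _; exact: sqr_ge0.
congr (_ * _); rewrite (reindex (fun w => map_tuple (q^-1)%g w))/=; last first.
  by apply: onW_bij; exact: map_tuple_perm_bij.
by apply: eq_bigr => w _; rewrite /tpermute map_tuple_permKV.
Qed.

(** The deterministic part. The bound on the noise is asked for every [s] because it is used at the
    inverse of [q], which depends on [E]. *)
Lemma borda_count_error {R : realType} {m d k l : nat} (Th B That E : tensor R m d)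
    (p q : 'S_d) (A C mu beta delta eps tau : R) :
  (0 < d)%N -> 0 <= A -> 0 < C -> 0 < beta -> 0 <= mu -> 0 <= eps -> 0 <= tau ->
  (forall (w w' : m.-tuple 'I_d) (h : R), 0 <= h ->
     (forall t, `|(tnth w t)%:R - (tnth w' t)%:R| / d%:R <= h) ->
     `|Th w - Th w'| <= A * h `^ mu) ->
  (forall i j : 'I_d, (j <= i)%N ->
     ((i%:R - j%:R) / d%:R) `^ beta^-1 <= C * (score Th i - score Th j)) ->
  block_poly k l B -> (forall w, `|Th w - B w| <= eps) ->
  is_borda_count k l (fun w => tpermute Th p w + E w) That q ->
  (forall i, `|score E i| <= delta) ->
  (forall (s : 'S_d) B1 B2, block_poly k l B1 -> block_poly k l B2 ->
     (\sum_w (B1 w - B2 w) * E (map_tuple s w)) ^+ 2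
     <= (\sum_w (B1 w - B2 w) ^+ 2) * tau) ->
  mse (tpermute That q) (tpermute Th p)
  <= 36 * ((A * ((2 * C * delta) `^ beta) `^ mu) ^+ 2 + eps ^+ 2) + 16 * (tau / d%:R ^+ m).
Proof.
move=> d0 A0 C0 b0 mu0 eps0 tau0 ThA mono polyB BTh [sorted polyT ls] Ed dom.
have dm0 : 0 < d%:R ^+ m :> R by rewrite exprn_gt0// ltr0n.
pose r := (2 * C * delta) `^ beta.
(* The product of [q^-1] and [p] sends a sorted position to the true position of the item placed
   there. *)
have disp i : `|(p ((q^-1)%g i))%:R - i%:R| / d%:R <= r.
  have := sorting_displacement d ((q^-1)%g * p)%g (score Th)
    (fun i => score E ((q^-1)%g i)) beta C delta b0 C0 mono.
  move=> /(_ _ _ i); rewrite permM; apply => // {}i j ij.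
  by have := sorted i j ij; rewrite !score_signal_noise !permM.
pose th w := Th (map_tuple p (map_tuple (q^-1)%g w)).
pose y w := tpermute (fun w => tpermute Th p w + E w) (q^-1)%g w.
have yth w : y w - th w = E (map_tuple (q^-1)%g w).
  by rewrite /y /th /tpermute addrAC subrr add0r.
rewrite mse_tpermute -/th.
have lsq := least_squares_error (m.-tuple 'I_d) y th B That tau.
rewrite mulrC ler_pdivrMr//; apply: (le_trans (lsq _ _ tau0)).
- have := ls B polyB; rewrite /frob ler_sqrt//.
  by apply: sumr_ge0 => w _; exact: sqr_ge0.
- under eq_bigr do rewrite yth.
  exact: dom.
rewrite [leRHS]mulrDl -[16 * _ * d%:R ^+ m]mulrA divfK ?gt_eqF// lerD2r.
(* The factor 18 of [least_squares_error], doubled by splitting [th - B] through [Th] into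
   misalignment and approximation error. *)
have -> : 36 * ((A * r `^ mu) ^+ 2 + eps ^+ 2) * d%:R ^+ m
    = 18 * \sum_(w : m.-tuple 'I_d) (2 * (A * r `^ mu) ^+ 2 + 2 * eps ^+ 2).
  by rewrite sumr_const card_tuple card_ord -[X in _ = 18 * X]mulr_natl natrX; ring.
rewrite ler_pM2l//; apply: ler_sum => w _.
have thTh : `|th w - Th w| <= A * r `^ mu.
  apply: ThA; first exact: powR_ge0.
  by move=> t; rewrite !tnth_map; exact: disp.
have sq1 : (th w - Th w) ^+ 2 <= (A * r `^ mu) ^+ 2.
  rewrite -[leLHS]real_normK ?num_real//; apply: lerXn2r; rewrite ?nnegrE//.
  by rewrite mulr_ge0// powR_ge0.
have sq2 : (Th w - B w) ^+ 2 <= eps ^+ 2.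
  by rewrite -[leLHS]real_normK ?num_real//; apply: lerXn2r; rewrite ?nnegrE.
have := sqr_ge0 ((th w - Th w) - (Th w - B w)).
by nra.
Qed.

Lemma card_slice_le (m d : nat) (i : 'I_d) : (0 < m)%N ->
  (#|[pred w : m.-tuple 'I_d | ohead w == Some i]| <= d ^ m.-1)%N.
Proof.
case: m => // m _.
have inj : {in [pred w : m.+1.-tuple 'I_d | ohead w == Some i] &,
    injective (fun w : m.+1.-tuple 'I_d => behead_tuple w)}.
  move=> w w'; case/tupleP: w => j w; case/tupleP: w' => j' w' /=.
  rewrite !inE /= => /eqP[->] /eqP[->] /(congr1 val)/= E.
  by apply: val_inj; rewrite /= E.
rewrite -(card_in_imset inj).
by apply: leq_trans (max_card _) _; rewrite card_tuple card_ord.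
Qed.

Lemma measure_union_le {dT : measure_display} {T : measurableType dT} {R : realType}
    (P : probability T R) (I : Type) (s : seq I) (B : I -> set T) :
  (forall i, measurable (B i)) ->
  measurable (\big[setU/set0]_(i <- s) B i) /\
  (P (\big[setU/set0]_(i <- s) B i) <= \sum_(i <- s) P (B i))%E.
Proof.
move=> mB; split; first exact: bigsetU_measurable.
elim: s => [|i s IH]; first by rewrite !big_nil measure0.
rewrite !big_cons; apply: le_trans (leeD2l _ IH).
by apply: measureU2 => //; exact: bigsetU_measurable.
Qed.

(** * The probability of the good event *)

Lemma card_perm_le (d : nat) : (#|{: 'S_d}| <= d ^ d)%N.
Proof.
have inj : injective (fun s : 'S_d => [ffun i => s i]).
  by move=> s s' /ffunP E; apply/permP => i; have := E i; rewrite !ffunE.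
by have := leq_card _ inj; rewrite card_ffun !card_ord.
Qed.

Lemma noise_event {dT : measure_display} {T : measurableType dT} {R : realType}
    (P : probability T R) (m d N : nat) (X : m.-tuple 'I_d -> {RV P >-> R})
    (e : 'I_N -> m.-tuple 'I_d -> R) :
  (0 < m)%N -> (1 < d)%N ->
  mutual_indep X -> (forall w, centered_subgaussian 1 (X w)) ->
  (forall j j', j != j' -> \sum_w e j w * e j' w = 0) ->
  (forall j, \sum_w e j w ^+ 2 <= 1) ->
  exists S : set T,
  [/\ measurable S, (1 - (2 / d%:R)%:E <= P S)%E
    & forall x, S x ->
      (forall i, `|score (fun w => X w x) i|
         <= Num.sqrt ((16 + 8 * ln d%:R) / d%:R ^+ m.-1)) /\
      (forall s : 'S_d, \sum_j (\sum_w e j w * X (map_tuple s w) x) ^+ 2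
         <= 16 * N%:R + 8 * (d%:R * ln d%:R))].
Proof.
move=> m0 d1 indX sgX orth nrm.
have dR1 : 1 < d%:R :> R by rewrite ltr1n.
have dR0 : 0 < d%:R :> R by apply: lt_trans dR1.
have ln0 : 0 <= ln d%:R :> R by rewrite ln_ge0// ltW.
have dm0 : 0 < d%:R ^+ m.-1 :> R by rewrite exprn_gt0.
have dln : 0 <= d%:R * ln d%:R :> R by rewrite mulr_ge0// ltW.
(* Chosen so that $4-t_1/4=-2\log d$ and $4N-t_2/4=-2d\log d$. *)
pose t1 : R := 16 + 8 * ln d%:R.
pose t2 : R := 16 * N%:R + 8 * (d%:R * ln d%:R).
have t10 : 0 <= t1 by rewrite addr_ge0// mulr_ge0.
have t20 : 0 <= t2 by rewrite addr_ge0// mulr_ge0.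
(* A slice indicator of norm at most 1: the score, rescaled by $\sqrt{d^{m-1}}$, becomes the
   one-dimensional case of the tail bound. *)
pose u i (w : m.-tuple 'I_d) : R := (ohead w == Some i)%:R / Num.sqrt (d%:R ^+ m.-1).
have mlin (a : m.-tuple 'I_d -> R) : measurable_fun [set: T] (fun x => \sum_w a w * X w x).
  by apply: measurable_sum => w; exact: measurable_funM.
have mtail n (a : 'I_n -> m.-tuple 'I_d -> R) t :
    measurable [set x | t <= \sum_j (\sum_w a j w * X w x) ^+ 2].
  have mS : measurable_fun [set: T] (fun x => \sum_j (\sum_w a j w * X w x) ^+ 2).
    by apply: measurable_sum => j; exact: measurable_funX.
  rewrite -[X in measurable X]setTI.
  rewrite (_ : [set x | _] = (fun x => \sum_j (\sum_w a j w * X w x) ^+ 2) @^-1` `[t, +oo[%classic).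
    exact: mS.
  by apply/seteqP; split=> x; rewrite /= in_itv/= andbT.
pose B1 i := [set x | t1 <= \sum_(j < 1) (\sum_w u i w * X w x) ^+ 2].
(* The permutation is shifted from the noise to the directions, which preserves orthogonality and
   norms, so the noise itself stays independent and sub-Gaussian. *)
pose e' (s : 'S_d) j w := e j (map_tuple (s^-1)%g w).
pose B2 s := [set x | t2 <= \sum_j (\sum_w e' s j w * X w x) ^+ 2].
have e'E s j (g : m.-tuple 'I_d -> R) :
    \sum_w e' s j w * g w = \sum_w e j w * g (map_tuple s w).
  rewrite (reindex (fun w => map_tuple s w))/=; last first.
    by apply: onW_bij; exact: map_tuple_perm_bij.
  by apply: eq_bigr => w _; rewrite /e' map_tuple_permK.
have P1 i : (P (B1 i) <= (expR (- (2 * ln d%:R)))%:E)%E.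
  have -> : - (2 * ln d%:R) = 4 * 1%:R - t1 / 4 :> R by rewrite /t1; lra.
  apply: (sum_sqr_lin_indep_tail P (m.-tuple 'I_d) X 1 (fun=> u i)) => //.
    by move=> j k; rewrite (ord1 j) (ord1 k) eqxx.
  move=> _; under eq_bigr do rewrite /u exprMn exprVn sqr_sqrtr ?ltW//.
  rewrite -mulr_suml ler_pdivrMr// mul1r.
  rewrite (eq_bigr (fun w : m.-tuple 'I_d => (ohead w == Some i)%:R)); last first.
    by move=> w _; case: (ohead w == _); rewrite ?expr1n ?expr0n.
  rewrite -natr_sum -natrX ler_nat -[X in (X <= _)%N]big_mkcond sum1_card.
  exact: card_slice_le.
have P2 s : (P (B2 s) <= (expR (- (2 * (d%:R * ln d%:R))))%:E)%E.
  have -> : - (2 * (d%:R * ln d%:R)) = 4 * N%:R - t2 / 4 :> R by rewrite /t2; lra.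
  apply: (sum_sqr_lin_indep_tail P (m.-tuple 'I_d) X N (e' s)) => //.
    move=> j k jk; rewrite e'E -[RHS](orth j k jk); apply: eq_bigr => w _.
    by rewrite /e' map_tuple_permK.
  move=> j; apply: le_trans (nrm j).
  under eq_bigr do rewrite expr2.
  rewrite e'E le_eqVlt; apply/orP; left; apply/eqP; apply: eq_bigr => w _.
  by rewrite /e' map_tuple_permK expr2.
have [mU1 PU1] := measure_union_le P 'I_d (index_enum 'I_d) B1 (fun i => mtail _ _ _).
have [mU2 PU2] := measure_union_le P 'S_d (index_enum {: 'S_d}) B2 (fun s => mtail _ _ _).
move: mU1 PU1 mU2 PU2.
set U1 := \big[_/_]_(i <- _) B1 i; set U2 := \big[_/_]_(i <- _) B2 i.
move=> mU1 PU1 mU2 PU2.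
have expln : expR (ln d%:R) = d%:R :> R by rewrite lnK// posrE.
have bound1 : (P U1 <= (d%:R^-1)%:E)%E.
  apply: (le_trans PU1).
  apply: (@le_trans _ _ (\sum_(i < d) (expR (- (2 * ln d%:R)))%:E)%E).
    by apply: lee_sum => i _; exact: P1.
  rewrite sumEFin lee_fin sumr_const card_ord -[leLHS]mulr_natl.
  have -> : - (2 * ln d%:R) = - ln d%:R - ln d%:R :> R by lra.
  by rewrite expRD expRN expln mulrA mulfV ?mul1r// gt_eqF.
have bound2 : (P U2 <= (d%:R^-1)%:E)%E.
  apply: (le_trans PU2).
  apply: (@le_trans _ _ (\sum_(s : 'S_d) (expR (- (2 * (d%:R * ln d%:R))))%:E)%E).
    by apply: lee_sum => s _; exact: P2.
  rewrite sumEFin lee_fin sumr_const -[leLHS]mulr_natl.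
  apply: (@le_trans _ _ ((d ^ d)%:R * expR (- (2 * (d%:R * ln d%:R))))).
    by rewrite ler_wpM2r ?expR_ge0// ler_nat card_perm_le.
  (* The union leaves $d^d\,d^{-2d}=d^{-d}\le d^{-1}$. *)
  rewrite natrX -[X in X ^+ _]expln -expRM_natl -expRD.
  rewrite -[X in X^-1]expln -expRN ler_expR.
  have : ln d%:R <= d%:R * ln d%:R :> R by rewrite ler_peMl// ltW.
  by lra.
exists (~` (U1 `|` U2)); split.
- by apply: measurableC; exact: measurableU.
- rewrite probability_setC; last exact: measurableU.
  apply: leeB => //; apply: (le_trans (measureU2 _ mU1 mU2)).
  apply: (le_trans (leeD bound1 bound2)).
  by rewrite -EFinD lee_fin; lra.
move=> x /= nU; split=> [i|s].
  have nB : ~ B1 i x.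
    by move=> Bi; apply: nU; left; rewrite /U1 -bigcup_seq; exists i => //=; rewrite mem_index_enum.
  have : (\sum_w u i w * X w x) ^+ 2 < t1.
    by rewrite ltNge; apply/negP => lt; apply: nB; rewrite /B1/= big_ord1.
  have -> : \sum_w u i w * X w x = score (fun w => X w x) i * Num.sqrt (d%:R ^+ m.-1).
    rewrite /score [in RHS]big_mkcond/= mulrAC mulr_sumr; apply: eq_bigr => w _.
    rewrite /u; have s0 : Num.sqrt (d%:R ^+ m.-1) != 0 :> R by rewrite gt_eqF// sqrtr_gt0.
    rewrite -{2}(sqr_sqrtr (ltW dm0)); case: (ohead w == Some i).
      by rewrite (_ : true%:R = 1 :> R)//; field.
    by rewrite !mul0r mulr0.
  rewrite exprMn (sqr_sqrtr (ltW dm0)) -ltr_pdivlMr// => /ltW lt.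
  by rewrite -sqrtr_sqr ler_wsqrtr.
have nB : ~ B2 s x.
  by move=> Bs; apply: nU; right; rewrite /U2 -bigcup_seq; exists s => //=; rewrite mem_index_enum.
have lt : \sum_j (\sum_w e' s j w * X w x) ^+ 2 < t2.
  by rewrite ltNge; apply/negP.
apply: le_trans (ltW lt); rewrite le_eqVlt; apply/orP; left; apply/eqP.
by apply: eq_bigr => j _; rewrite e'E.
Qed.

(** * Rates *)

Lemma opt_degree_le_holder_order {R : realType} (alpha beta : R) (m : nat) :
  (2 <= m)%N -> 0 < alpha -> 0 < beta * Num.min alpha 1 <= 1 ->
  (opt_degree alpha beta m <= holder_order alpha)%N.
Proof.
move=> m2 a0 hab; rewrite -lez_nat opt_degreeE// holder_orderE//.
by rewrite ge_min lexx.
Qed.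

(** Why the degree may be capped: no smoothness below [crit] is lost, and beyond [crit] the sorting
    error dominates anyway. The strict floor plus one is the ceiling, hence at least [crit]. *)
Lemma min_crit_le_opt_degree {R : realType} (alpha beta : R) (m : nat) :
  (2 <= m)%N -> 0 < alpha -> 0 < beta * Num.min alpha 1 <= 1 ->
  Num.min alpha (crit alpha beta m) <= (opt_degree alpha beta m)%:R + 1.
Proof.
move=> m2 a0 hab; have -> : (opt_degree alpha beta m)%:R =
    (Num.min (Num.ceil (alpha - 1)) (strict_floor (crit alpha beta m)))%:~R :> R.
  by rewrite -(opt_degreeE m2 a0 hab).
have ca : alpha - 1 <= (Num.ceil (alpha - 1))%:~R by rewrite -ceil_le_int.
have cc : crit alpha beta m <= (Num.ceil (crit alpha beta m))%:~R by rewrite -ceil_le_int.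
rewrite ge_min; have [_|_] := leP (Num.ceil (alpha - 1)) (strict_floor (crit alpha beta m)).
  by rewrite -lerBlDr ca.
by rewrite /strict_floor intrB subrK cc orbT.
Qed.

(** Clearing denominators turns both sides into the same inequality, linear in [x]; the denominator
    of [crit] is positive because $\beta\min(\alpha,1)\le1$. *)
Lemma variance_exponent_lt {R : realType} (alpha beta x : R) (m : nat) :
  (2 <= m)%N -> 0 < beta * Num.min alpha 1 <= 1 -> 0 < x ->
  (2 * m%:R * x / (m%:R + 2 * x) < (m%:R - 1) * (beta * Num.min alpha 1))
  = (x < crit alpha beta m).
Proof.
move=> m2 /andP[b0 b1] x0.
have -> : crit alpha beta m = m%:R * (m%:R - 1) * (beta * Num.min alpha 1)
    / (2 * (m%:R - (m%:R - 1) * (beta * Num.min alpha 1))).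
  by rewrite /crit !mulrA.
set b := beta * _ in b0 b1 *.
have mR : 2 <= m%:R :> R by rewrite ler_nat.
have den : 0 < m%:R - (m%:R - 1) * b.
  have : (m%:R - 1) * b <= m%:R - 1 by rewrite ler_piMr//; lra.
  by lra.
rewrite ltr_pdivrMr; last lra.
rewrite ltr_pdivlMr; last lra.
by rewrite -subr_gt0 -[RHS]subr_gt0; congr (_ < _); ring.
Qed.

Lemma powR_ln_le {R : realType} (b x : R) : 0 < b -> 0 < x ->
  exists2 K : R, 0 < K & forall d : nat, (1 < d)%N -> ln d%:R `^ b <= K * d%:R `^ x.
Proof.
(* $\log u<u$ at $u=d^{x/b}$, then raised to the power $b$. *)
move=> b0 x0; pose y := x / b.
have y0 : 0 < y by rewrite divr_gt0.
exists ((y^-1) `^ b); first by rewrite powR_gt0// invr_gt0.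
move=> d d1.
have dR1 : 1 < d%:R :> R by rewrite ltr1n.
have dR0 : 0 < d%:R :> R by apply: lt_trans dR1.
have ln0 : 0 <= ln d%:R :> R by rewrite ln_ge0// ltW.
have -> : d%:R `^ x = (d%:R `^ y) `^ b by rewrite -powRrM divfK// gt_eqF.
rewrite -powRM ?invr_ge0 ?powR_ge0 ?(ltW y0)//.
have lny : ln d%:R <= y^-1 * d%:R `^ y.
  rewrite ler_pdivlMl// -ln_powR.
  by apply: le_trans (ltW (ln_sublinear _)) _ => //; rewrite powR_gt0.
apply: ge0_ler_powR; rewrite ?nnegrE// ?(ltW b0)//.
exact: le_trans lny.
Qed.

Lemma expR1_le4 {R : realType} : expR 1 <= 4 :> R.
Proof.
have h : 2^-1 <= expR (- 2^-1 : R) by apply: le_trans (expR_ge1Dx _); lra.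
have e1 : expR (- 1 : R) = expR (- 2^-1) * expR (- 2^-1).
  by rewrite -expRD; congr expR; lra.
rewrite -lef_pV2 ?posrE ?expR_gt0// -expRN e1.
by have := ler_pM _ _ h h; rewrite invr_ge0 => /(_ (ler0n _ _) (ler0n _ _)); lra.
Qed.

(** Below [crit] the gap between the two exponents is strict and absorbs the power of the logarithm.
    From [crit] on, the fitting term is at most the sorting term because $\log d\ge1$, which $d\ge4$
    ensures. *)
Lemma sum_rates_le_borda_rate {R : realType} (alpha beta : R) (m : nat) :
  (2 <= m)%N -> 0 < alpha -> 0 < beta * Num.min alpha 1 <= 1 ->
  let a := Num.min alpha ((opt_degree alpha beta m)%:R + 1) in
  exists2 K : R, 0 < K & forall d, (4 <= d)%N ->
    (ln d%:R / d%:R ^+ m.-1) `^ (beta * Num.min alpha 1)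
      + d%:R `^ (- (2 * m%:R * a / (m%:R + 2 * a)))
    <= K * borda_rate alpha beta m d.
Proof.
move=> m2 a0 hab a; have /andP[b0 b1] := hab.
set b := beta * Num.min alpha 1 in b0 b1 *.
have aa : 0 < a by rewrite lt_min a0 ltr_wpDl.
have ma : Num.min alpha (crit alpha beta m) <= a.
  by rewrite le_min ge_min lexx/= min_crit_le_opt_degree.
have m1R : m.-1%:R = m%:R - 1 :> R by rewrite -subn1 natrB// ltnW.
have splitE d : (4 <= d)%N -> (ln d%:R / d%:R ^+ m.-1) `^ b
    = ln d%:R `^ b * d%:R `^ (- ((m%:R - 1) * b)) :> R.
  move=> d3; have dR1 : 1 <= d%:R :> R by rewrite ler1n (leq_trans _ d3).
  rewrite powRM ?ln_ge0// ?invr_ge0 ?exprn_ge0//.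
  by rewrite -powR_mulrn// m1R -powRN -powRrM mulNr.
have [lt|ge] := ltP alpha (crit alpha beta m); last first.
  exists 2 => // d d3.
  have dR1 : 1 < d%:R :> R by rewrite ltr1n (leq_trans _ d3).
  rewrite /borda_rate ltNge ge/= -/b [leRHS]mulrDl !mul1r lerD2l splitE//.
  have ln1 : 1 <= ln d%:R :> R.
    rewrite -ler_expR lnK ?posrE; last by apply: lt_trans dR1.
    apply: (@le_trans _ _ 4); last by rewrite ler_nat.
    exact: expR1_le4.
  apply: (@le_trans _ _ (d%:R `^ (- ((m%:R - 1) * b)))).
    rewrite ler_powR//; first exact: ltW.
    rewrite lerN2 leNgt variance_exponent_lt// -leNgt.
    by apply: le_trans ma; rewrite (min_idPr ge).
  rewrite ler_peMl ?powR_ge0//; apply: (@le_trans _ _ (1 `^ b)); first by rewrite powR1.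
  by apply: ge0_ler_powR; rewrite ?nnegrE// ltW// (lt_le_trans ltr01).
have aE : a = alpha.
  by apply/eqP; rewrite eq_le ge_min lexx/= (le_trans _ ma)// (min_idPl (ltW lt)).
rewrite aE; set g := 2 * m%:R * alpha / (m%:R + 2 * alpha).
have gap : 0 < (m%:R - 1) * b - g by rewrite subr_gt0 variance_exponent_lt.
have [K K0 HK] := powR_ln_le b _ b0 gap.
exists (K + 1); first by rewrite addr_gt0.
move=> d d3; rewrite /borda_rate lt -/g [leRHS]mulrDl mul1r lerD2r splitE//.
have d0 : d%:R != 0 :> R by rewrite pnatr_eq0 -lt0n (leq_trans _ d3).
apply: (@le_trans _ _ (K * d%:R `^ ((m%:R - 1) * b - g) * d%:R `^ (- ((m%:R - 1) * b)))).
  by rewrite ler_wpM2r ?powR_ge0// HK// (leq_trans _ d3).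
rewrite -mulrA -powRD; last by rewrite d0 implybT.
by rewrite addrAC subrr add0r.
Qed.

Lemma error_terms_le {R : realType} (m : nat) (A1 A2 C c1 c2 a beta mu : R) (K0 : nat) :
  (1 < m)%N -> 0 < C -> 0 < c1 -> 0 < c2 -> 0 < a -> 0 < beta * mu <= 1 ->
  exists2 K : R, 0 < K & forall d k : nat, (4 <= d)%N -> 1 <= ln d%:R :> R ->
    c1 * d%:R `^ (m%:R / (m%:R + 2 * a)) <= k%:R <= c2 * d%:R `^ (m%:R / (m%:R + 2 * a)) ->
    36 * ((A1 * ((2 * C * Num.sqrt ((16 + 8 * ln d%:R) / d%:R ^+ m.-1)) `^ beta) `^ mu) ^+ 2
          + (A2 * k%:R^-1 `^ a) ^+ 2)
      + 16 * ((16 * (k ^ m * K0)%:R + 8 * (d%:R * ln d%:R)) / d%:R ^+ m)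
    <= K * ((ln d%:R / d%:R ^+ m.-1) `^ (beta * mu)
            + d%:R `^ (- (2 * m%:R * a / (m%:R + 2 * a)))).
Proof.
move=> m1 C0 c10 c20 a0 /andP[b0 b1].
pose b := beta * mu.
have mR : 1 < m%:R :> R by rewrite ltr1n.
have mR0 : 0 < m%:R :> R by lra.
have ma0 : 0 < m%:R + 2 * a by lra.
(* 96 comes from $4C^2(16+8\log d)\le 96\,C^2\log d$ when $\log d\ge1$. *)
pose K1 := A1 ^+ 2 * (96 * C ^+ 2) `^ b.
pose K2 := A2 ^+ 2 * (c1^-1 `^ a) ^+ 2.
pose K3 := K0%:R * c2 ^+ m.
have K10 : 0 <= K1 by rewrite mulr_ge0 ?sqr_ge0 ?powR_ge0.
have K20 : 0 <= K2 by rewrite mulr_ge0 ?sqr_ge0.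
have K30 : 0 <= K3 by rewrite mulr_ge0// exprn_ge0// ltW.
exists (36 * (K1 + K2) + 256 * K3 + 128); first lra.
move=> d k d4 ln1 /andP[klo khi].
have dR1 : 1 < d%:R :> R by rewrite ltr1n (leq_trans _ d4).
have dR0 : 0 < d%:R :> R by lra.
have dm0 n : 0 < d%:R ^+ n :> R by rewrite exprn_gt0.
pose rho := m%:R / (m%:R + 2 * a).
pose g := 2 * m%:R * a / (m%:R + 2 * a).
pose lam : R := ln d%:R / d%:R ^+ m.-1.
have lam0 : 0 <= lam by rewrite divr_ge0// ltW//; lra.
have lam1 : lam <= 1.
  rewrite ler_pdivrMr// mul1r; apply: (@le_trans _ _ d%:R).
    exact/ltW/ln_sublinear.
  by rewrite -[leLHS]expr1 ler_eXn2l// -ltnS prednK// ltnW.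
have D0 : 0 < d%:R `^ rho by rewrite powR_gt0.
have k0 : 0 < k%:R :> R by apply: lt_le_trans klo; rewrite mulr_gt0.
have T1 : (A1 * ((2 * C * Num.sqrt ((16 + 8 * ln d%:R) / d%:R ^+ m.-1)) `^ beta) `^ mu) ^+ 2
    <= K1 * lam `^ b.
  rewrite /K1 exprMn -[leRHS]mulrA ler_wpM2l ?sqr_ge0// -powRrM -/b.
  have q0 : 0 <= (16 + 8 * ln d%:R) / d%:R ^+ m.-1 :> R.
    by rewrite divr_ge0 ?(ltW (dm0 _))//; lra.
  set x := 2 * C * _.
  have x0 : 0 <= x by rewrite mulr_ge0 ?sqrtr_ge0//; lra.
  have -> : (x `^ b) ^+ 2 = (x ^+ 2) `^ b.
    by rewrite -!powR_mulrn ?powR_ge0// -!powRrM mulrC.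
  have C96 : 0 <= 96 * C ^+ 2 by rewrite mulr_ge0// sqr_ge0.
  rewrite -powRM//; apply: ge0_ler_powR; rewrite ?nnegrE ?sqr_ge0//; first exact: ltW.
    exact: mulr_ge0.
  rewrite /x exprMn sqr_sqrtr// /lam !mulrA ler_pM2r ?invr_gt0//.
  have : 0 <= C ^+ 2 * (ln d%:R - 1) by rewrite mulr_ge0 ?sqr_ge0 ?subr_ge0.
  by nra.
have T2 : (A2 * k%:R^-1 `^ a) ^+ 2 <= K2 * d%:R `^ (- g).
  rewrite exprMn /K2 -[leRHS]mulrA ler_wpM2l ?sqr_ge0//.
  apply: (@le_trans _ _ (((c1 * d%:R `^ rho)^-1 `^ a) ^+ 2)).
    apply: lerXn2r; rewrite ?nnegrE ?powR_ge0//.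
    apply: ge0_ler_powR; rewrite ?nnegrE ?invr_ge0 ?(ltW a0) ?(ltW k0)//.
      by rewrite mulr_ge0 ?(ltW c10) ?(ltW D0).
    by rewrite lef_pV2 ?posrE ?mulr_gt0.
  rewrite invfM powRM ?invr_ge0 ?(ltW c10) ?(ltW D0)// exprMn ler_wpM2l ?sqr_ge0//.
  rewrite -powRN -powRrM -(@powR_mulrn _ (d%:R `^ _)) ?powR_ge0// -powRrM.
  rewrite le_eqVlt; apply/orP; left; apply/eqP; congr (_ `^ _).
  by rewrite /rho /g; field; lra.
(* The order of [k] balances this variance term with the squared bias in [T2]: both have the power
   $d^{-g}$. *)
have T3 : (k ^ m)%:R / d%:R ^+ m <= c2 ^+ m * d%:R `^ (- g).
  rewrite natrX ler_pdivrMr//.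
  apply: (@le_trans _ _ ((c2 * d%:R `^ rho) ^+ m)).
    by apply: lerXn2r; rewrite ?nnegrE ?(ltW k0) ?mulr_ge0 ?(ltW c20) ?(ltW D0).
  rewrite exprMn -[leRHS]mulrA ler_wpM2l ?exprn_ge0 ?(ltW c20)//.
  rewrite -!powR_mulrn ?powR_ge0 ?(ltW dR0)// -powRrM -powRD; last by rewrite (gt_eqF dR0) implybT.
  rewrite le_eqVlt; apply/orP; left; apply/eqP; congr (_ `^ _).
  by rewrite /rho /g; field; lra.
have T4 : d%:R * ln d%:R / d%:R ^+ m <= lam `^ b.
  have -> : d%:R * ln d%:R / d%:R ^+ m = lam.
    have -> : d%:R ^+ m = d%:R * d%:R ^+ m.-1 :> R by rewrite -exprS prednK// ltnW.
    by rewrite /lam invfM mulrACA divff ?mul1r// gt_eqF.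
  have [->|ln0] := eqVneq lam 0; first exact: powR_ge0.
  have lamE : lam `^ b * lam `^ (1 - b) = lam.
    by rewrite -powRD ?ln0 ?implybT// addrC subrK powRr1.
  rewrite -[leLHS]lamE ler_piMr ?powR_ge0//.
  apply: (@le_trans _ _ (1 `^ (1 - b))); last by rewrite powR1.
  by apply: ge0_ler_powR; rewrite ?nnegrE// subr_ge0.
have -> : (16 * (k ^ m * K0)%:R + 8 * (d%:R * ln d%:R)) / d%:R ^+ m
    = 16 * (K0%:R * ((k ^ m)%:R / d%:R ^+ m)) + 8 * (d%:R * ln d%:R / d%:R ^+ m) :> R.
  by rewrite natrM; ring.
have g0 : 0 <= d%:R `^ (- g) by exact: powR_ge0.
have l0 : 0 <= lam `^ b by exact: powR_ge0.
rewrite -/lam -/g -/b.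
have T3' : K0%:R * ((k ^ m)%:R / d%:R ^+ m) <= K3 * d%:R `^ (- g).
  by rewrite /K3 -mulrA ler_wpM2l.
have := mulr_ge0 K10 g0; have := mulr_ge0 K20 l0; have := mulr_ge0 K30 l0.
by move: T1 T2 T3' T4; lra.
Qed.

(** * The bound with high probability *)

Theorem theorem4 (R : realType) (m : nat) (L alpha beta : R)
    (f : 'rV[R]_m -> R) (k : nat -> nat)
    (hm : (2 <= m)%N) (hL : 0 < L) (halpha : 0 < alpha) (hbeta : 0 < beta)
    (hab : 0 < beta * Num.min alpha 1 <= 1)
    (hf : holder alpha L f) (hmon : monotonic beta f)
    (hk : same_order (fun d => (k d)%:R : R)
       (fun d => d%:R `^ (m%:R / (m%:R + 2 *
          Num.min alpha ((opt_degree alpha beta m)%:R + 1))))) :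
  exists2 C : R, 0 < C &
  forall (dT : nat -> measure_display) (T : forall d, measurableType (dT d))
    (P : forall d, probability (T d) R)
    (E : forall d, m.-tuple 'I_d -> {RV (P d) >-> R})
    (perm : forall d, 'S_d)
    (That : forall d, T d -> tensor R m d)
    (phat : forall d, T d -> 'S_d),
  (forall d, mutual_indep (E d)) ->
  (forall d w, centered_subgaussian 1 (E d w)) ->
  (forall d x,
     is_borda_count (k d) (opt_degree alpha beta m)
       (fun w => tpermute (sample f) (perm d) w + E d w x)
       (That d x) (phat d x)) ->
  with_high_probability P (fun d => [set x |
    mse (tpermute (That d x) (phat d x)) (tpermute (sample f) (perm d))
    <= C * borda_rate alpha beta m d]).

Proof.
have m1 : (0 < m)%N by exact: ltnW.
have /andP[b0 b1] := hab.
have mu0 : 0 <= Num.min alpha 1 by rewrite le_min ltW//= ler01.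
pose l := opt_degree alpha beta m.
pose a := Num.min alpha (l%:R + 1).
have a0 : 0 < a by rewrite lt_min halpha ltr_wpDl.
have [A1 A10 HA1] := holder_continuity_modulus m L alpha f halpha (ltW hL) hf.
have [A2 A20 HA2] := block_poly_approx m L alpha f l halpha (ltW hL) hf
  (opt_degree_le_holder_order alpha beta m hm halpha hab).
have [C C0 HC] := hmon.
have [c1 [c2 [c10 c20 [n0 _ Hk]]]] := hk.
pose K0 := #|{: bmultinom m l.+1}|.
have [K K_gt0 HK] := error_terms_le m A1 A2 C c1 c2 a beta (Num.min alpha 1) K0
  hm C0 c10 c20 a0 hab.
have [K' K'_gt0 HK'] := sum_rates_le_borda_rate alpha beta m hm halpha hab.
exists (K * K'); first exact: mulr_gt0.
move=> dT T P E perm That phat indE sgE borda.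
pose Ev d := [set x | mse (tpermute (That d x) (phat d x)) (tpermute (sample f) (perm d))
    <= K * K' * borda_rate alpha beta m d].
pose d0 := maxn 4 n0.
(* Below [d0] the empty set is taken, since only the limit matters. The measurable set comes from
   the noise and is then shown to lie in [Ev d]. *)
have event d : exists S : set (T d), [/\ measurable S, S `<=` Ev d
    & (d0 <= d)%N -> (1 - (2 / d%:R)%:E <= P d S)%E].
  have [dd|dd] := leqP d0 d; last by exists set0; split => //; exact: sub0set.
  have d4 : (4 <= d)%N by apply: leq_trans dd; rewrite leq_maxl.
  have dn0 : (n0 <= d)%N by apply: leq_trans dd; rewrite leq_maxr.
  have d_gt1 : (1 < d)%N by apply: leq_trans d4.
  have dR0 : 0 < d%:R :> R by rewrite ltr0n (leq_trans _ d4).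
  have kd := Hk d dn0.
  have k0 : (0 < k d)%N.
    by rewrite -(ltr0n R); case/andP: kd => kd _; apply: lt_le_trans kd; rewrite mulr_gt0// powR_gt0.
  have ln1 : 1 <= ln d%:R :> R.
    by rewrite -ler_expR lnK ?posrE// (le_trans expR1_le4)// ler_nat.
  have [e [orth nrm dom]] := block_poly_dominating_family (R := R) m d (k d) l k0.
  have [S [mS PS HS]] := noise_event (P d) m d _ (E d) e m1 d_gt1 (indE d) (sgE d) orth nrm.
  exists S; split => // x Sx; have [score_le dom_le] := HS x Sx.
  have [B polyB BTh] := HA2 d (k d) k0.
  pose tau : R := 16 * (k d ^ m * K0)%:R + 8 * (d%:R * ln d%:R).
  have tau0 : 0 <= tau.
    by rewrite addr_ge0 ?mulr_ge0 ?(ltW dR0) ?(le_trans ler01 ln1).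
  (* Indices are 0-based while coordinates are $(i+1)/d$; the shift cancels in differences. *)
  have smooth (w w' : m.-tuple 'I_d) (h : R) : 0 <= h ->
      (forall t, `|(tnth w t)%:R - (tnth w' t)%:R| / d%:R <= h) ->
      `|sample f w - sample f w'| <= A1 * h `^ Num.min alpha 1.
    move=> h0 ww'; apply: HA1 => //; [exact: sample_point_cube|exact: sample_point_cube|].
    move=> t; apply: le_trans (ww' t).
    rewrite !mxE -mulrBl normrM [`|_^-1|]gtr0_norm ?invr_gt0//.
    have -> // : (tnth w t).+1%:R - (tnth w' t).+1%:R
        = (tnth w t)%:R - (tnth w' t)%:R :> R.
    by rewrite -!natr1; ring.
  have := borda_count_error (sample f) B (That d x) (fun w => E d w x) (perm d) (phat d x)
    A1 C (Num.min alpha 1) beta _ _ tau (ltnW d_gt1) A10 C0 hbeta mu0 _ tau0 smooth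
    (HC d) polyB BTh (borda d x) score_le.
  move=> /(_ _ _)/le_trans; apply.
  - by rewrite mulr_ge0// powR_ge0.
  - move=> s B1 B2 polyB1 polyB2; apply: le_trans (dom B1 B2 _ polyB1 polyB2) _.
    by rewrite ler_wpM2l ?dom_le// sumr_ge0// => w _; exact: sqr_ge0.
  apply: le_trans (HK d (k d) d4 ln1 kd) _.
  by rewrite -[leRHS]mulrA ler_pM2l//; exact: HK'.
pose A d := projT1 (cid (event d)).
exists A; split=> [d|d|]; rewrite /A; try by case: (cid (event d)) => S /= [].
apply: (@squeeze_cvge _ _ _ _ (fun d : nat => (1 - (2 / d%:R)%:E)%E) _ (fun=> 1%E)).
- near=> d; rewrite probability_le1 ?andbT; last by case: (cid (event d)) => S /= [].
  case: (cid (event d)) => S /= [_ _]; apply.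
  by near: d; exact: nbhs_infty_ge.
- rewrite (_ : (fun d : nat => _) = EFin \o (fun d : nat => 1 - 2 / d%:R : R))//.
  apply/cvg_EFin; first by near=> d.
  apply/cvgrPdist_le => eps eps0; near=> d.
  rewrite /= opprB addrC subrK ger0_norm ?divr_ge0//.
  have d_gt0 : 0 < d%:R :> R by rewrite ltr0n; near: d; exact: nbhs_infty_gt.
  rewrite ler_pdivrMr// mulrC -ler_pdivrMr//.
  by near: d; exact: nbhs_infty_ger.
- exact: cvg_cst.
Unshelve. all: by end_near.
Qed.
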